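(* Let $n\in\mathbb{N}$ and let $\sigma$ be a probability distribution on $[n]=\{1,\dots,n\}$ such that $\sigma_{\le i}>\tfrac{i}{n}$ for every $i\in[n-1]$. Consider the $\sigma$-MultiQueue and let $(r_1^{(s)},\dots,r_n^{(s)})$ be the ranks of its top-elements after $s$ deletions. Then, as $s\to\infty$, $(r_1^{(s)},\dots,r_n^{(s)})$ converges in distribution to the random vector $(r_1,\dots,r_n)$ defined by \[ r_i = 1+\sum_{j=1}^{i-1}\delta_j \quad (i\in[n]),\] where $\delta_1,\dots,\delta_{n-1}$ are independent random variables with $\delta_i\sim \mathrm{Geom}_1\!\left(1-\frac{i}{n\,\sigma_{\le i}}\right)$ for $i\in[n-1]$.
   Context: For a probability distribution $\sigma$ on $[n]$ write $\sigma_i=\Pr_{i^*\sim\sigma}[i^*=i]$ and $\sigma_{\le i}=\Pr_{i^*\sim\sigma}[i^*\le i]$. The $\sigma$-MultiQueue: take an infinite totally ordered set of elements $x_1<x_2<x_3<\cdots$ and assign each element independently and uniformly at random to one of $n$ priority queues. The queues (identified with the sets of elements they contain) are labelled $Q_1,\dots,Q_n$ so that $\min Q_1<\min Q_2<\dots<\min Q_n$; these minima are the top-elements. A deletion samples $i\sim\sigma$ (independently of everything else), removes $\min Q_i$ from $Q_i$, and then relabels the queues so that their top-elements are again in increasing order. After $s$ deletions the queues are $Q_1^{(s)},\dots,Q_n^{(s)}$, and $r_i^{(s)}$ denotes the rank of $\min Q_i^{(s)}$ within $Q_1^{(s)}\cup\dots\cup Q_n^{(s)}$ (the smallest element has rank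 $1$). $\mathrm{Geom}_1(p)$ denotes the distribution of the number of independent Bernoulli($p$) trials up to and including the first success (support $\{1,2,\dots\}$). *)

(* Defs.v *)
From HB Require Import structures.
From mathcomp Require Import all_boot all_order all_algebra.
From mathcomp Require Import boolp classical_sets reals ereal topology normedtype
  sequences measure probability.
Set Implicit Arguments. Unset Strict Implicit. Unset Printing Implicit Defensive.
Import Order.TTheory GRing.Theory Num.Theory.
Local Open Scope classical_set_scope.
Local Open Scope ring_scope.

(* Elements x_1 < x_2 < ... are represented by the naturals 0,1,2,... *)
(* (element x_{k+1} is k).  An assignment a : nat -> 'I_n sends each   *)
(* element to one of the n (unlabelled) queues.  D : seq nat is the    *)
(* list of elements deleted so far.                                    *)

(* top element (minimum) of queue j once the elements of D are removed;
   None if the queue is empty (a probability-zero situation). *)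
Definition qtop (n : nat) (a : nat -> 'I_n) (D : seq nat) (j : 'I_n) : option nat :=
  match pselect (exists k, (a k == j) && (k \notin D)) with
  | left H => Some (@ex_minn (fun k => (a k == j) && (k \notin D)) H)
  | right _ => None
  end.

(* the top-elements in increasing order: the i-th entry (0-based) is
   min Q_{i+1} for the labelling min Q_1 < min Q_2 < ... *)
Definition tops (n : nat) (a : nat -> 'I_n) (D : seq nat) : seq nat :=
  sort leq (pmap (qtop a D) (enum 'I_n)).

(* one deletion: the sampled label c (0-based, i.e. label c+1) has its
   top element removed *)
Definition mq_step (n : nat) (a : nat -> 'I_n) (D : seq nat) (c : 'I_n) : seq nat :=
  if (c < size (tops a D))%N then nth 0%N (tops a D) c :: D else D.

(* elements removed after s deletions; c t is the label sampled at the
   (t+1)-st deletion *)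
Fixpoint mq_removed (n : nat) (a : nat -> 'I_n) (c : nat -> 'I_n) (s : nat) : seq nat :=
  match s with
  | 0 => [::]
  | s'.+1 => mq_step a (mq_removed a c s') (c s')
  end.

Definition rank_in (D : seq nat) (x : nat) : nat :=
  (count (fun k => k \notin D) (iota 0 x)).+1.

(* r_{i+1}^{(s)} for i : 'I_n (0 if the queue has no top, prob. zero) *)
Definition mq_rank (n : nat) (a : nat -> 'I_n) (c : nat -> 'I_n) (s : nat) (i : 'I_n) : nat :=
  let D := mq_removed a c s in
  let t := tops a D in
  if (i < size t)%N then rank_in D (nth 0%N t i) else 0%N.

(* sigma_{<= i} : labels 1..i are the 0-based indices j < i *)
Definition sigma_le (R : realType) (n : nat) (sigma : 'I_n -> R) (i : nat) : R :=
  \sum_(j < n | (j < i)%N) sigma j.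

Definition discrete_rvs d (T : measurableType d) (I V : Type) (X : I -> T -> V) :=
  forall i v, measurable [set w | X i w = v].

Definition mutually_independent d (T : measurableType d) (R : realType)
  (P : probability T R) (I : eqType) (V : Type) (X : I -> T -> V) :=
  forall (J : seq I) (x : I -> V), uniq J ->
    fine (P [set w | forall j, j \in J -> X j w = x j]) =
    \prod_(j <- J) fine (P [set w | X j w = x j]).

Definition join_rv (I1 I2 T V : Type) (A : I1 -> T -> V) (C : I2 -> T -> V)
  : I1 + I2 -> T -> V :=
  fun x => match x with inl k => A k | inr t => C t end.

(* pmf of Geom_1(p): number of Bernoulli(p) trials up to and including
   the first success *)
Definition geom1_pmf (R : realType) (p : R) (k : nat) : R :=
  if k == 0%N then 0 else (1 - p) ^+ k.-1 * p.

(* limit vector: r_{i+1} = 1 + sum_{j=1}^{i} delta_j, where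
   Delta j (j : 'I_n.-1) represents delta_{j+1} *)
Definition limit_rank (n : nat) (T : Type) (Delta : 'I_n.-1 -> T -> nat) (w : T)
  (i : 'I_n) : nat :=
  (1 + \sum_(j < n.-1 | (j < i)%N) Delta j w)%N.

(* Main.v *)
(* After [s] deletions, read off the infinite word formed by the queues of the remaining
   elements in increasing order: a deletion with label [c] erases the first occurrence of
   the [c]-th new letter.  Let [g_s u] be the probability that this word starts with [u].
   When [u] contains all [n] letters, the words that become [u] by an erasure are obtained
   from [u] by inserting a letter [l] somewhere before its first occurrence, so
   [g_(s+1) = K g_s] for an explicit finite positive operator [K].
   The weight giving a factor [1 / (n sigma_(<= k))] to each repeated letter preceded by
   [k] distinct letters is fixed by [K]: for each [l] the sum over the insertion position
   telescopes.  Normalised, it is the law of the limit vector.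
   The initial weight [n ^- |u|] is bounded by a multiple of the stationary one, hence so
   are all [g_s]; this tightness, together with the fact that [m] successive deletions of
   the minimum simply discard the first [m] letters, gives a Doeblin-type contraction of
   the l^1 distance to the stationary weight, which therefore tends to [0]. *)
Require Import Defs.
From HB Require Import structures.
From mathcomp Require Import all_boot all_order all_algebra.
From mathcomp Require Import boolp classical_sets reals ereal topology normedtype
  sequences measure probability.
From mathcomp Require Import ring lra.
Import Order.TTheory GRing.Theory Num.Theory numFieldNormedType.Exports.
Set Implicit Arguments. Unset Strict Implicit. Unset Printing Implicit Defensive.
Local Open Scope classical_set_scope.
Local Open Scope ring_scope.

Local Notation set0 := finset.set0.
Local Notation setT := finset.setT.

(** * Words over the queue labels and insertion of an erased letter *)

Section Words.
Variable n : nat.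
Implicit Types (s : {set 'I_n}) (u y : seq 'I_n) (x l : 'I_n).

(** Throughout, [s] is the set of letters read before [u]; recursions on words move the head letter
    into [s]. *)
Definition covers s u := [forall x, (x \in s) || (x \in u)].
Definition full u := covers set0 u.

Fixpoint words N : seq (seq 'I_n) :=
  if N is N'.+1 then [seq x :: u | x <- enum 'I_n, u <- words N'] else [:: [::]].

(* The pairs (c, y) such that y is u with a new first occurrence of l inserted,
   preceded by c distinct letters, when the letters of s have already been read. *)
Fixpoint preds s l u {struct u} : seq (nat * seq 'I_n) :=
  (#|s|, l :: u) ::
  (if u is x :: u' then
     if x == l then [::] else [seq (e.1, x :: e.2) | e <- preds (x |: s) l u']
   else [::]).

Lemma covers_cons s x u : covers s (x :: u) = covers (x |: s) u.
Proof.
by apply: eq_forallb => z; rewrite !inE orbA [(z \in s) || _]orbC.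
Qed.

Lemma covers_nil s : covers s [::] = (s == setT).
Proof.
apply/forallP/eqP => [h|-> x]; last by rewrite inE.
by apply/setP => x; have := h x; rewrite orbF !inE => ->.
Qed.

Lemma coversT u : covers setT u.
Proof. by apply/forallP => x; rewrite inE. Qed.

Lemma fullP u : reflect (forall x, x \in u) (full u).
Proof.
apply: (iffP forallP) => h x; have := h x; rewrite inE //=.
Qed.

Lemma full_sub u y : {subset u <= y} -> full u -> full y.
Proof. by move=> h /fullP fu; apply/fullP => x; apply: h. Qed.

Lemma full_enum : full (enum 'I_n).
Proof. by apply/fullP => x; rewrite mem_enum. Qed.

Lemma mem_words N u : (u \in words N) = (size u == N).
Proof.
elim: N u => [|N IH] [|x u] //=.
- by apply/allpairsP => -[[? ?] []].
- rewrite eqSS -IH; apply/allpairsP/idP => [[[z w] /= [_ hw [_ ->]]] //|hu].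
  by exists (x, u); rewrite mem_enum.
Qed.

Lemma words_uniq N : uniq (words N).
Proof.
elim: N => //= N IH; apply: allpairs_uniq => //; first exact: enum_uniq.
by move=> [x u] [z w] _ _ /= [-> ->].
Qed.

Lemma big_words0 (V : nmodType) (F : seq 'I_n -> V) :
  \sum_(u <- words 0) F u = F [::].
Proof. by rewrite big_seq1. Qed.

Lemma big_wordsS (V : nmodType) N (F : seq 'I_n -> V) :
  \sum_(u <- words N.+1) F u = \sum_x \sum_(u <- words N) F (x :: u).
Proof. by rewrite /= big_allpairs_dep big_enum. Qed.

Lemma big_words_rcons (V : nmodType) N (F : seq 'I_n -> V) :
  \sum_(u <- words N.+1) F u = \sum_(u <- words N) \sum_x F (rcons u x).
Proof.
elim: N F => [|N IH] F.
  by rewrite big_wordsS big_words0; apply: eq_bigr => x _; rewrite big_words0.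
rewrite big_wordsS big_wordsS; apply: eq_bigr => x _.
by rewrite (IH (fun u => F (x :: u))).
Qed.

Lemma preds_perm s l u e : e \in preds s l u -> perm_eq e.2 (l :: u).
Proof.
elim: u s e => [|x u IH] s e /=; first by rewrite inE => /eqP->.
rewrite inE => /orP[/eqP-> //|]; case: eqP => // _ /mapP[e' /IH h ->] /=.
by rewrite perm_sym (perm_catCA [:: l] [:: x] u) /= perm_cons perm_sym.
Qed.

Lemma preds_rcons s l u x : l \in u ->
  preds s l (rcons u x) = [seq (e.1, rcons e.2 x) | e <- preds s l u].
Proof.
elim: u s => //= z u IH s; rewrite inE [l == z]eq_sym; case: (eqVneq z l) => [//|nzl /=].
move=> lu; congr (_ :: _).
by rewrite (IH _ lu) -!map_comp.
Qed.

End Words.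

(** Once [y] is within [(1 - q) * (e / 2)] of [l], the error contracts by [q] at each step, and the
    accumulated forcing is a geometric series of sum at most [e / 2]. *)
Lemma cvg_affine_rec (R : realType) (q l : R) (x y : nat -> R) :
  0 <= q -> q < 1 -> (forall N, x N.+1 = q * x N + y N) ->
  y @ \oo --> l -> x @ \oo --> l / (1 - q).
Proof.
move=> q0 q1 xE yl; have q1' : 0 < 1 - q by rewrite subr_gt0.
set L := l / (1 - q); have LE : L = q * L + l by rewrite /L; field; rewrite gt_eqF.
apply/cvgrPdist_le => e e0; have e20 : 0 < e / 2 by rewrite divr_gt0.
have [N0 _ H] : \forall N \near \oo, `|l - y N| <= (1 - q) * (e / 2).
  by move/cvgrPdist_le : yl; apply; rewrite mulr_gt0.
pose B := `|L - x N0|.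
have bnd j : `|L - x (N0 + j)%N| <= q ^+ j * B + e / 2.
  elim: j => [|j IH]; first by rewrite addn0 mul1r lerDl ltW.
  have -> : L - x (N0 + j.+1)%N = q * (L - x (N0 + j)%N) + (l - y (N0 + j)%N).
    by rewrite addnS xE {1}LE; ring.
  apply: le_trans (ler_normD _ _) _; rewrite normrM (ger0_norm q0).
  have h1 := ler_wpM2l q0 IH; have h2 := H (N0 + j)%N (leq_addr _ _).
  by apply: le_trans (lerD h1 h2) _; rewrite exprS; lra.
have : (fun j => q ^+ j * B) @ \oo --> 0 * B.
  by apply: cvgM; [apply: cvg_expr; rewrite ger0_norm|exact: cvg_cst].
rewrite mul0r => /cvgrPdist_le /(_ _ e20) [N1 _ H1].
exists (N0 + N1)%N => // N /= hN.
have -> : N = (N0 + (N - N0))%N by rewrite subnKC // (leq_trans (leq_addr _ _) hN).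
apply: le_trans (bnd _) _.
have := H1 (N - N0)%N; rewrite /= leq_subRL ?hN; last first.
  exact: leq_trans (leq_addr _ _) hN.
move=> /(_ isT); rewrite sub0r normrN => /(le_trans (ler_norm _)) h; lra.
Qed.

(** * The weight recursion and its stationary weight *)

Section Chain.
Variables (R : realType) (n : nat) (t : nat -> R).
Hypothesis n_gt0 : (0 < n)%N.
Hypothesis t0 : t 0 = 0.
Hypothesis t_mono : forall k, t k <= t k.+1.
Hypothesis t_le1 : forall k, t k <= 1.
Hypothesis tn : t n = 1.
Hypothesis t_gt : forall k, (0 < k < n)%N -> k%:R / n%:R < t k.
Implicit Types (s : {set 'I_n}) (u y : seq 'I_n) (x l : 'I_n) (g h : seq 'I_n -> R).

Let sn k := t k.+1 - t k.
Let nR_gt0 : 0 < n%:R :> R. Proof. by rewrite ltr0n. Qed.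
Let nR_neq0 : n%:R != 0 :> R. Proof. by rewrite gt_eqF. Qed.

Lemma sn_ge0 k : 0 <= sn k. Proof. by rewrite subr_ge0. Qed.

Lemma t_gt0 k : (0 < k)%N -> 0 < t k.
Proof.
have t1 : 0 < t 1.
  case: (ltnP 1 n) => h.
    by apply: le_lt_trans (t_gt (k := 1) _); rewrite ?h // divr_ge0.
  have n1 : n = 1%N by apply/eqP; rewrite eqn_leq h n_gt0.
  by move: tn; rewrite n1 => ->.
case: k => // k _; elim: k => // k IH; exact: lt_le_trans IH (t_mono _).
Qed.

Lemma sn0_gt0 : 0 < sn 0. Proof. by rewrite /sn t0 subr0 t_gt0. Qed.

(** The failure probability of the [k]-th geometric gap. At [k = 0] the numerator makes it [0],
    although [t 0 = 0]. *)
Definition gap_ratio k : R := k%:R / (n%:R * t k).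

Lemma gap_ratio_ge0 k : 0 <= gap_ratio k.
Proof.
case: k => [|k]; first by rewrite /gap_ratio mul0r.
by rewrite divr_ge0 // mulr_ge0 ?ltW ?t_gt0.
Qed.

Lemma gap_ratio_lt1 k : (k < n)%N -> gap_ratio k < 1.
Proof.
case: k => [|k] kn; first by rewrite /gap_ratio mul0r.
have h : k.+1%:R / n%:R < t k.+1 by rewrite t_gt.
rewrite /gap_ratio ltr_pdivrMr ?mulr_gt0 ?t_gt0 // mul1r mulrC.
by rewrite ltr_pdivrMr in h.
Qed.

(* Unnormalised stationary weight of u when the letters of s have already been read. *)
Fixpoint word_wt s u : R :=
  if u is x :: u' then (if x \in s then (n%:R * t #|s|)^-1 else 1) * word_wt (x |: s) u'
  else 1.

Lemma word_wt_ge0 s u : 0 <= word_wt s u.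
Proof.
elim: u s => //= x u IH s; rewrite mulr_ge0 //; case: ifP => // xs.
rewrite invr_ge0 mulr_ge0 ?ltW ?t_gt0 //; by apply/card_gt0P; exists x.
Qed.

(* Summing over the position at which the deleted letter l sat telescopes. *)
Lemma word_wt_preds s l u : l \notin s -> l \in u ->
  \sum_(e <- preds s l u) sn e.1 * word_wt s e.2
  = word_wt s u / n%:R - t #|s| * word_wt (l |: s) u.
Proof.
elim: u s => // x u IH s ls lu.
have tS : t #|s|.+1 != 0 by rewrite gt_eqF ?t_gt0.
have cl : #|l |: s| = #|s|.+1 by rewrite cardsU1 ls.
rewrite /=; case: (eqVneq x l) => [->|nxl] /=.
  rewrite big_seq1 /= !inE (negPf ls) cl eqxx /= finset.setUA finset.setUid /sn.
  by field; rewrite ?nR_neq0 ?tS.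
have lu' : l \in u by move: lu; rewrite inE eq_sym (negPf nxl).
have lxs : l \notin x |: s by rewrite !inE negb_or eq_sym nxl ls.
rewrite big_cons big_map /= !inE (negPf nxl) (negPf ls) cl /=.
under eq_bigr => e _ do rewrite mulrCA.
rewrite -mulr_sumr IH // [l |: (x |: s)]finset.setUCA.
set A := word_wt _ u; set B := word_wt _ u.
case: (boolP (x \in s)) => xs.
  have -> : #|x |: s| = #|s| by rewrite (finset.setUidPr _) ?finset.sub1set.
  have ts : t #|s| != 0 by rewrite gt_eqF ?t_gt0 //; apply/card_gt0P; exists x.
  by rewrite /sn; field; rewrite ?nR_neq0 ?ts ?tS.
by rewrite cardsU1 xs /= add1n /sn; field; rewrite ?nR_neq0 ?tS.
Qed.

(** A word [y] and a label [c] determine the erased word, so [g y] is met at most once per label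
    [c >= #|s|], and the probabilities of these labels add up to [1 - t #|s|]. *)
Lemma mass_preds g s N : (forall u, 0 <= g u) ->
  \sum_(u <- words n N) \sum_(l | l \notin s) \sum_(e <- preds s l u) sn e.1 * g e.2
  <= (1 - t #|s|) * \sum_(y <- words n N.+1) g y.
Proof.
elim: N g s => [|N IH] g s g0.
  rewrite big_words0 big_wordsS mulr_sumr [leRHS](bigID (fun l => l \notin s)) /= -[leLHS]addr0.
  apply: lerD; last first.
    by apply: sumr_ge0 => x _; rewrite big_words0 mulr_ge0 // subr_ge0.
  apply: ler_sum => x _; rewrite big_words0 big_seq1 /=.
  by apply: ler_wpM2r => //; rewrite /sn lerD2r.
rewrite [in leRHS]big_wordsS.
(* Split according to whether the first letter [x] of the predecessor is the inserted letter, which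
   must be new, or the unchanged first letter of [u]. *)
have -> : \sum_(u <- words n N.+1) \sum_(l | l \notin s) \sum_(e <- preds s l u) sn e.1 * g e.2
  = \sum_x ((x \notin s)%:R * sn #|s| * (\sum_(y <- words n N.+1) g (x :: y))
     + \sum_(u <- words n N) \sum_(l | l \notin x |: s)
         \sum_(e <- preds (x |: s) l u) sn e.1 * g (x :: e.2)).
  rewrite big_split /=.
  rewrite (eq_bigr (fun u => \sum_(l | l \notin s) sn #|s| * g (l :: u)
    + (if u is x :: u' then \sum_(l | l \notin x |: s)
         \sum_(e <- preds (x |: s) l u') sn e.1 * g (x :: e.2) else 0))); last first.
    move=> [|x u] _.
      by rewrite addr0; apply: eq_bigr => l _; rewrite big_seq1.
    rewrite (bigID (fun l => l == x)) /= [in RHS](bigID (fun l => l == x)) /= -addrA; congr (_ + _).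
      apply: eq_bigr => l /andP[_ /eqP->]; rewrite big_cons eqxx big_nil addr0 //.
    rewrite (eq_bigl (fun l => (l \notin s) && (l != x))
      (fun l => \sum_(e <- preds (x |: s) l u) _)); last first.
      by move=> l; rewrite !inE negb_or andbC.
    rewrite -big_split /=; apply: eq_bigr => l /andP[_ nlx].
    by rewrite big_cons /= eq_sym (negPf nlx) big_map.
  rewrite big_split /=; congr (_ + _); last by rewrite big_wordsS.
  rewrite exchange_big /= big_mkcond /=; apply: eq_bigr => x _.
  by case: (x \notin s); rewrite ?mul1r ?mul0r // mulr_sumr.
rewrite mulr_sumr; apply: ler_sum => x _.
apply: (le_trans (lerD (lexx _) (IH (fun u => g (x :: u)) _ (fun u => g0 _)))).
rewrite -mulrDl; apply: ler_wpM2r; first by apply: sumr_ge0.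
case: (boolP (x \in s)) => xs /=.
  have -> : #|x |: s| = #|s| by rewrite (finset.setUidPr _) ?finset.sub1set.
  by rewrite mul0r add0r.
by rewrite cardsU1 xs /= add1n mul1r /sn; lra.
Qed.

(** The operator [K] of one random deletion. If [u] misses a letter, the erased letter may lie
    beyond its end and insertions into [u] do not exhaust the predecessors; the value is then set to
    [0]. *)
Definition del_op g u : R :=
  if full u then \sum_l \sum_(e <- preds set0 l u) sn e.1 * g e.2 else 0.

Definition lsum N g : R := \sum_(u <- words n N) g u.

(* g is a cylinder weight on full words: the letters read once all n letters have
   appeared are independent and uniform. *)
Definition admissible g :=
  (forall u x, full u -> g (rcons u x) = g u / n%:R) /\ (forall u, ~~ full u -> g u = 0).

Lemma full_preds l u e : full u -> e \in preds set0 l u -> full e.2.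
Proof.
move=> fu /preds_perm /perm_mem ee; apply: full_sub fu => x xu.
by rewrite ee inE xu orbT.
Qed.

Lemma admissible_sub g h : admissible g -> admissible h -> admissible (fun u => g u - h u).
Proof.
move=> [g1 g2] [h1 h2]; split=> [u x fu|u fu]; last by rewrite g2 // h2 // subr0.
by rewrite g1 // h1 // mulrBl.
Qed.

Lemma admissible_abs g : admissible g -> admissible (fun u => `|g u|).
Proof.
move=> [g1 g2]; split=> [u x fu|u fu]; last by rewrite g2 // normr0.
by rewrite g1 // normrM normfV [X in _ / X]ger0_norm.
Qed.

Lemma admissible_scale a g : admissible g -> admissible (fun u => a * g u).
Proof.
move=> [g1 g2]; split=> [u x fu|u fu]; last by rewrite g2 // mulr0.
by rewrite g1 // mulrA.
Qed.

Lemma admissible_del_op g : admissible g -> admissible (del_op g).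
Proof.
move=> [g1 g2]; split=> [u x fu|u /negPf fu]; last by rewrite /del_op fu.
have fux : full (rcons u x).
  by apply: full_sub fu => z zu; rewrite mem_rcons inE zu orbT.
rewrite /del_op fu fux mulr_suml; apply: eq_bigr => l _.
rewrite preds_rcons; last by apply/fullP.
rewrite big_map mulr_suml; apply: eq_big_seq => e eu /=.
by rewrite g1 ?mulrA // (full_preds fu eu).
Qed.

Lemma admissible_iter_del m g : admissible g -> admissible (iter m del_op g).
Proof. by move=> ag; elim: m => //= m; apply: admissible_del_op. Qed.

Lemma del_op_ge0 g : (forall u, 0 <= g u) -> forall u, 0 <= del_op g u.
Proof.
move=> g0 u; rewrite /del_op; case: ifP => // _.
apply: sumr_ge0 => l _; rewrite sumr_ge0 // => e _; by rewrite mulr_ge0 // sn_ge0.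
Qed.

Lemma iter_del_ge0 m g : (forall u, 0 <= g u) -> forall u, 0 <= iter m del_op g u.
Proof. by move=> g0; elim: m => //= m; apply: del_op_ge0. Qed.

Lemma del_op_lin a b g h :
  del_op (fun u => a * g u + b * h u) = (fun u => a * del_op g u + b * del_op h u).
Proof.
apply/funext => u; rewrite /del_op; case: ifP => _; last by rewrite !mulr0 addr0.
rewrite !mulr_sumr -big_split; apply: eq_bigr => l _ /=.
rewrite !mulr_sumr -big_split; apply: eq_bigr => e _ /=; ring.
Qed.

Lemma iter_del_lin m a b g h :
  iter m del_op (fun u => a * g u + b * h u)
  = (fun u => a * iter m del_op g u + b * iter m del_op h u).
Proof. by elim: m => //= m ->; rewrite del_op_lin. Qed.

Lemma lsum_lin N a b g h : lsum N (fun u => a * g u + b * h u) = a * lsum N g + b * lsum N h.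
Proof. by rewrite /lsum big_split /= -!mulr_sumr. Qed.

Lemma lsum_ge N g u : (forall u, 0 <= g u) -> size u = N -> g u <= lsum N g.
Proof.
move=> g0 su; have uw : u \in words n N by rewrite mem_words su.
rewrite /lsum (bigD1_seq u) ?words_uniq //= lerDl; exact: sumr_ge0.
Qed.

(** A full word passes its weight on to its [n] extensions, while words that become full only at
    length [N.+1] add mass. *)
Lemma lsum_leS N g : admissible g -> (forall u, 0 <= g u) -> lsum N g <= lsum N.+1 g.
Proof.
move=> [g1 g2] g0; rewrite /lsum big_words_rcons; apply: ler_sum => u _.
case: (boolP (full u)) => fu; last by rewrite g2 // sumr_ge0.
rewrite (eq_bigr (fun=> g u / n%:R)); last by move=> x _; rewrite g1.
by rewrite sumr_const card_ord -[leRHS]mulr_natr divfK.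
Qed.

Lemma lsum_homo N N' g : admissible g -> (forall u, 0 <= g u) ->
  (N <= N')%N -> lsum N g <= lsum N' g.
Proof.
move=> ag g0 /subnKC <-; elim: (_ - _)%N => [|k IH]; first by rewrite addn0.
by apply: le_trans IH _; rewrite addnS; apply: lsum_leS.
Qed.

Lemma lsum_del_op N g : (forall u, 0 <= g u) -> lsum N (del_op g) <= lsum N.+1 g.
Proof.
move=> g0; have := mass_preds set0 N g0; rewrite cards0 t0 subr0 mul1r.
apply: le_trans; apply: ler_sum => u _; rewrite /del_op.
under eq_bigl => l do rewrite -[true]/(~~ false) -(finset.in_set0 l).
case: ifP => // _; apply: sumr_ge0 => l _; apply: sumr_ge0 => e _.
by rewrite mulr_ge0 // sn_ge0.
Qed.

Lemma lsum_iter_del m N g : (forall u, 0 <= g u) -> lsum N (iter m del_op g) <= lsum (N + m) g.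
Proof.
move=> g0; elim: m N => [|m IH] N; first by rewrite addn0.
rewrite addnS -addSn /=; apply: le_trans (IH _).
by apply: lsum_del_op; apply: iter_del_ge0.
Qed.

(* Deleting the global minimum m times discards the first m letters. *)
Lemma iter_del_lb m g b : (forall u, 0 <= g u) -> full b ->
  sn 0 ^+ m * \sum_(y <- words n m) g (y ++ b) <= iter m del_op g b.
Proof.
move=> g0 fb; elim: m g g0 => [|m IH] g g0; first by rewrite expr0 mul1r big_words0.
rewrite iterSr; apply: le_trans (IH _ (del_op_ge0 g0)).
rewrite exprSr -mulrA ler_wpM2l ?exprn_ge0 ?sn_ge0 // big_wordsS exchange_big mulr_sumr /=.
apply: ler_sum => y _; rewrite /del_op.
have -> : full (y ++ b) by apply: full_sub fb => x xb; rewrite mem_cat xb orbT.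
rewrite mulr_sumr; apply: ler_sum => l _.
case: (y ++ b) => [|x u] /=; first by rewrite big_seq1 cards0.
rewrite big_cons cards0 lerDl sumr_ge0 // => e _; by rewrite mulr_ge0 ?sn_ge0.
Qed.

Lemma admissible_cat g u y : admissible g -> full u -> g (u ++ y) = g u * n%:R^-1 ^+ size y.
Proof.
move=> [g1 g2] fu; elim/last_ind: y => [|y x IH]; first by rewrite cats0 mulr1.
rewrite -rcons_cat g1 ?IH ?size_rcons ?exprSr ?mulrA //.
by apply: full_sub fu => z zu; rewrite mem_cat zu.
Qed.

(** Doeblin minorisation: behind [m] letters that already form a full word the next letters are
    uniform, so every full [b] receives a fixed fraction of the mass at length [m]. *)
Lemma iter_del_lb_lsum m g b : admissible g -> (forall u, 0 <= g u) -> full b ->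
  sn 0 ^+ m * n%:R^-1 ^+ size b * lsum m g <= iter m del_op g b.
Proof.
move=> ag g0 fb; apply: le_trans (iter_del_lb m g0 fb).
rewrite -mulrA ler_wpM2l ?exprn_ge0 ?sn_ge0 // mulr_sumr; apply: ler_sum => y _.
case: (boolP (full y)) => fy; last by case: ag => _ ->; rewrite ?mulr0.
by rewrite admissible_cat // mulrC.
Qed.

(** The positive and negative parts of [g] both send mass to one word [b], where it cancels; the
    minorisation bounds this loss from below. *)
Lemma lsum_contract m N g : admissible g -> (n <= N)%N ->
  lsum N (fun u => `|iter m del_op g u|)
  + sn 0 ^+ m * n%:R^-1 ^+ n * (lsum m (fun u => `|g u|) - `|lsum m g|)
  <= lsum (N + m) (fun u => `|g u|).
Proof.
(* Any full word would do for [b]; this one has length [n <= N], so its weight is counted in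
   [lsum N]. *)
move=> ag nN; set b := enum 'I_n; set a := fun u => `|g u|.
have aa : admissible a by apply: admissible_abs.
have a0 u : 0 <= a u by exact: normr_ge0.
(* The minorisation applied to the two nonnegative weights [a + g] and [a - g]. *)
have bpm (e : bool) : sn 0 ^+ m * n%:R^-1 ^+ n * (lsum m a + (-1) ^+ e * lsum m g)
    <= iter m del_op a b + (-1) ^+ e * iter m del_op g b.
  have := @iter_del_lb_lsum m (fun u => 1 * a u + (-1) ^+ e * g u) b.
  rewrite lsum_lin iter_del_lin !mul1r size_enum_ord; apply; last exact: full_enum.
  - split=> [u x fu|u fu]; last by rewrite aa.2 // ag.2 // !mulr0 addr0.
    by rewrite aa.1 // ag.1 // mulrDl !mulrA.
  - move=> u; rewrite mul1r; case: e; rewrite ?expr0 ?expr1 ?mul1r ?mulN1r.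
      by rewrite subr_ge0 ler_norm.
    by rewrite -[g u]opprK subr_ge0 /a -normrN ler_norm.
have dom u : `|iter m del_op g u| <= iter m del_op a u.
  have := @iter_del_ge0 m (fun u => 1 * a u + 1 * g u); rewrite iter_del_lin => p1.
  have := @iter_del_ge0 m (fun u => 1 * a u + (-1) * g u); rewrite iter_del_lin => p2.
  rewrite ler_norml; apply/andP; split.
    rewrite lerNl -subr_ge0 opprK; have := p1 _ u; rewrite !mul1r; apply => z.
    by rewrite !mul1r -[g z]opprK subr_ge0 /a -normrN ler_norm.
  rewrite -subr_ge0; have := p2 _ u; rewrite mul1r mulN1r; apply => z.
  by rewrite mul1r mulN1r subr_ge0 ler_norm.
(* The cancelled mass: nonnegative by [dom], and bounded below at [b] by the instance of [bpm] that
   matches the sign of the iterate there. *)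
pose h := fun u => iter m del_op a u - `|iter m del_op g u|.
have ah : admissible h.
  by apply: admissible_sub; [apply: admissible_iter_del|apply/admissible_abs/admissible_iter_del].
have h0 u : 0 <= h u by rewrite subr_ge0.
have hb : sn 0 ^+ m * n%:R^-1 ^+ n * (lsum m a - `|lsum m g|) <= h b.
  have := bpm true; have := bpm false; rewrite expr0 expr1 !mul1r !mulN1r /h.
  set c := sn 0 ^+ m * _; have c0 : 0 <= c by rewrite mulr_ge0 ?exprn_ge0 ?sn_ge0 ?invr_ge0.
  move=> e1 e2; case: (ger0P (iter m del_op g b)) => _.
    apply: le_trans e2; rewrite ler_wpM2l // lerD2l lerN2 ler_norm //.
  rewrite opprK; apply: le_trans e1; rewrite ler_wpM2l // lerD2l lerNl -normrN ler_norm //.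
have hS : h b <= lsum N h.
  apply: le_trans (lsum_homo ah h0 nN); apply: lsum_ge => //; exact: size_enum_ord.
have := lsum_iter_del m N a0; apply: le_trans.
have -> : lsum N (iter m del_op a) = lsum N (fun u => `|iter m del_op g u|) + lsum N h.
  by rewrite /lsum -big_split; apply: eq_bigr => u _; rewrite /h /= addrC subrK.
by rewrite lerD2l (le_trans hb).
Qed.

(** * Total mass and invariance of the stationary weight *)

Lemma word_wt_rcons s u x : covers s u -> word_wt s (rcons u x) = word_wt s u / n%:R.
Proof.
elim: u s => [|z u IH] s /=; last by rewrite covers_cons => /IH ->; rewrite mulrA.
by rewrite covers_nil => /eqP ->; rewrite finset.in_setT cardsT card_ord tn !mulr1 mul1r.
Qed.

(** Split on the first letter: the [#|s|] old letters reproduce the same sum with total factor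
    [gap_ratio #|s|], while a new one lowers the number of missing letters. This is an affine
    recursion in [N]. *)
Lemma word_wt_words_cvg s :
  (fun N => \sum_(u <- words n N | covers s u) word_wt s u) @ \oo
  --> \prod_(#|s| <= k < n) ((n - k)%:R / (1 - gap_ratio k)).
Proof.
have [m] := ubnP (n - #|s|); elim: m s => // m IH s; rewrite ltnS => sm.
have := subset_leq_card (finset.subsetT s); rewrite cardsT card_ord leq_eqVlt => /orP[|sn'].
  (* No letter is missing: each of the [n ^ N] words of length [N] weighs [n ^- N]. *)
  rewrite -[X in _ == X](card_ord n) -cardsT => sE.
  have {sE}sE : s = setT by apply/eqP; rewrite eqEcard finset.subsetT (eqP sE) /=.
  rewrite {}sE cardsT card_ord big_geq //; apply: cvg_near_cst; apply: nearW => N.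
  rewrite (eq_bigl xpredT); last by move=> u; rewrite coversT.
  elim: N => [|N IHN]; first by rewrite big_words0.
  rewrite big_wordsS (eq_bigr (fun=> n%:R^-1)); last first.
    move=> x _; rewrite /= finset.in_setT cardsT card_ord tn mulr1 finset.setUT.
    by rewrite -mulr_sumr IHN mulr1.
  by rewrite sumr_const card_ord -[LHS]mulr_natl mulfV.
rewrite big_ltn // mulrAC.
apply: (@cvg_affine_rec R (gap_ratio #|s|) _ _
  (fun N => \sum_(x | x \notin s) \sum_(u <- words n N | covers (x |: s) u) word_wt (x |: s) u)).
- exact: gap_ratio_ge0.
- exact: gap_ratio_lt1.
- move=> N; rewrite [LHS]big_mkcond big_wordsS (bigID (fun x => x \in s)) /=; congr (_ + _).
    rewrite (eq_bigr (fun=> (n%:R * t #|s|)^-1 * \sum_(u <- words n N | covers s u) word_wt s u)).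
      by rewrite sumr_const -[LHS]mulr_natl mulrA.
    move=> x xs; rewrite mulr_sumr [RHS]big_mkcond; apply: eq_bigr => u _.
    by rewrite covers_cons (finset.setUidPr _) ?finset.sub1set // xs.
  apply: eq_bigr => x /negPf xs; rewrite [RHS]big_mkcond; apply: eq_bigr => u _.
  by rewrite covers_cons xs mul1r.
- have -> : (n - #|s|)%:R * \prod_(#|s|.+1 <= k < n) ((n - k)%:R / (1 - gap_ratio k))
    = \sum_(x | x \notin s) \prod_(#|x |: s| <= k < n) ((n - k)%:R / (1 - gap_ratio k)).
    rewrite [RHS](eq_bigr (fun=> \prod_(#|s|.+1 <= k < n) ((n - k)%:R / (1 - gap_ratio k)))); last first.
      by move=> x xs; rewrite cardsU1 xs add1n.
    rewrite sumr_const -[RHS]mulr_natl; congr (_%:R * _).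
    by rewrite -{1}(card_ord n) -(cardC (mem s)) addKn; apply: eq_card => x; rewrite !inE.
  apply: cvg_big => [|x xs]; first exact: add_continuous.
  apply: IH; rewrite cardsU1 xs add1n subnS.
  by rewrite prednK // subn_gt0.
Qed.

Definition norm_cst : R := \prod_(0 <= k < n) ((1 - gap_ratio k) / (n - k)%:R).
Definition stationary u : R := if full u then norm_cst * word_wt set0 u else 0.

Lemma norm_cst_gt0 : 0 < norm_cst.
Proof.
rewrite /norm_cst big_mkord; apply: prodr_gt0 => k _.
by rewrite divr_gt0 ?subr_gt0 ?gap_ratio_lt1 // ltr0n subn_gt0.
Qed.

Lemma stationary_ge0 u : 0 <= stationary u.
Proof. by rewrite /stationary; case: ifP => // _; rewrite mulr_ge0 ?word_wt_ge0 ?ltW ?norm_cst_gt0. Qed.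

Lemma admissible_stationary : admissible stationary.
Proof.
split=> [u x fu|u /negPf fu]; rewrite /stationary; last by rewrite fu.
rewrite fu (full_sub _ fu) => [|z zu]; last by rewrite mem_rcons inE zu orbT.
by rewrite word_wt_rcons // mulrA.
Qed.

(** By [word_wt_preds] with [t 0 = 0], each of the [n] letters contributes the same share [1 / n] of
    the weight of [u]. *)
Lemma del_op_stationary : del_op stationary = stationary.
Proof.
apply/funext => u; rewrite /del_op /stationary; case: ifP => // fu.
rewrite (eq_bigr (fun=> norm_cst * word_wt set0 u / n%:R)); last first.
  move=> l _; have lu : l \in u by apply/fullP.
  have := @word_wt_preds set0 l u; rewrite finset.in_set0 cards0 t0 mul0r subr0 -mulrA => <- //.
  rewrite mulr_sumr; apply: eq_big_seq => e eu.
  by rewrite (full_preds fu eu) mulrCA.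
by rewrite sumr_const card_ord -[LHS]mulr_natr divfK.
Qed.

Lemma lsum_stationary_cvg : (fun N => lsum N stationary) @ \oo --> (1 : R).
Proof.
have -> : (fun N => lsum N stationary)
    = (fun N => norm_cst * \sum_(u <- words n N | covers set0 u) word_wt set0 u).
  by apply/funext => N; rewrite /lsum mulr_sumr [RHS]big_mkcond.
suff -> : 1 = norm_cst * \prod_(#|set0 : {set 'I_n}| <= k < n) ((n - k)%:R / (1 - gap_ratio k)).
  by apply: cvgM; [exact: cvg_cst | exact: word_wt_words_cvg].
rewrite cards0 -big_split big_nat big1 // => k /andP[_ kn] /=.
have h1 : 1 - gap_ratio k != 0 by rewrite gt_eqF ?subr_gt0 ?gap_ratio_lt1.
have h2 : (n - k)%:R != 0 :> R by rewrite pnatr_eq0 -lt0n subn_gt0.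
by rewrite mulrA divfK // mulfV.
Qed.

Lemma lsum_le_lim g (l : R) N : admissible g -> (forall u, 0 <= g u) ->
  (fun N => lsum N g) @ \oo --> l -> lsum N g <= l.
Proof.
move=> ag g0 gl; rewrite -(cvg_lim _ gl) //.
apply: (nondecreasing_cvgn_le (u_ := fun N => lsum N g)).
  by move=> i j; apply: lsum_homo.
by apply/cvg_ex; exists l.
Qed.

Lemma iter_del_sub m g h :
  iter m del_op (fun u => g u - h u) = (fun u => iter m del_op g u - iter m del_op h u).
Proof.
have E g1 h1 : (fun u => g1 u - h1 u) = (fun u => 1 * g1 u + (-1) * h1 u).
  by apply/funext => u; rewrite mul1r mulN1r.
by rewrite E iter_del_lin -E.
Qed.

Lemma iter_del_stationary m : iter m del_op stationary = stationary.
Proof. by elim: m => //= m ->; rewrite del_op_stationary. Qed.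

Lemma iter_del_scale m a g : iter m del_op (fun u => a * g u) = (fun u => a * iter m del_op g u).
Proof.
have E g1 : (fun u => a * g1 u) = (fun u => a * g1 u + 0 * g1 u).
  by apply/funext => u; rewrite mul0r addr0.
by rewrite E iter_del_lin -E.
Qed.

Lemma lsum_sub N g h : lsum N (fun u => g u - h u) = lsum N g - lsum N h.
Proof. by rewrite /lsum sumrB. Qed.

Lemma lsum_scale N a g : lsum N (fun u => a * g u) = a * lsum N g.
Proof. by rewrite /lsum mulr_sumr. Qed.

(** * Convergence to the stationary weight in [l^1] *)

Section Convergence.
Variables (g : seq 'I_n -> R) (M : R).
Hypotheses (ag : admissible g) (g_ge0 : forall u, 0 <= g u) (M_ge0 : 0 <= M)
  (gM : forall u, g u <= M * stationary u) (Sg : (fun N => lsum N g) @ \oo --> (1 : R)).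

Let nu k u := iter k del_op g u - stationary u.
(** The stationary mass not yet visible on words of length [N]; it tends to [0] and controls all the
    tails below. *)
Let eps N := 1 - lsum N stationary.
Let c := M + 1.

Lemma eps_ge0 N : 0 <= eps N.
Proof.
rewrite subr_ge0; apply: lsum_le_lim; last exact: lsum_stationary_cvg.
  exact: admissible_stationary.
exact: stationary_ge0.
Qed.

Lemma admissible_nu k : admissible (nu k).
Proof. by apply: admissible_sub; [exact: admissible_iter_del|exact: admissible_stationary]. Qed.

Lemma iter_del_le k u : iter k del_op g u <= M * stationary u.
Proof.
rewrite -subr_ge0.
have := @iter_del_ge0 k (fun u => M * stationary u - g u).
rewrite iter_del_sub iter_del_scale iter_del_stationary; apply=> z; by rewrite subr_ge0.
Qed.

Lemma nu_le k u : `|nu k u| <= c * stationary u.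
Proof.
have := iter_del_le k u; have := iter_del_ge0 k g_ge0 u; have := stationary_ge0 u.
rewrite /nu /c ler_norml mulrDl mul1r => h1 h2 h3.
have : 0 <= M * stationary u by rewrite mulr_ge0.
by move=> h4; apply/andP; split; lra.
Qed.

(** Deletion creates no mass, which bounds the mass of the iterate by [1]. The same fact for
    [M * stationary u - g u], nonnegative of total mass [M - 1], bounds it from below. *)
Lemma lsum_nu_le k N : `|lsum N (nu k)| <= c * eps N.
Proof.
have e0 := eps_ge0 N.
have h1 : lsum N (iter k del_op g) <= 1.
  by apply: le_trans (lsum_iter_del k N g_ge0) _; apply: lsum_le_lim.
have h2 : M * lsum N stationary - lsum N (iter k del_op g) <= M - 1.
  have ad : admissible (fun u => M * stationary u - g u).
    by apply: admissible_sub => //; apply/admissible_scale/admissible_stationary.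
  have ge u : 0 <= M * stationary u - g u by rewrite subr_ge0.
  have := lsum_iter_del k N ge.
  rewrite iter_del_sub iter_del_scale iter_del_stationary lsum_sub lsum_scale.
  move=> /le_trans; apply; apply: lsum_le_lim => //.
  have -> : (fun N => lsum N (fun u => M * stationary u - g u))
      = (fun N => M * lsum N stationary - lsum N g).
    by apply/funext => N'; rewrite lsum_sub lsum_scale.
  apply: cvgB => //; rewrite -[X in _ --> X]mulr1.
  by apply: cvgM; [exact: cvg_cst|exact: lsum_stationary_cvg].
have h3 : 0 <= M * eps N by rewrite mulr_ge0.
rewrite /nu lsum_sub ler_norml /c mulrDl mul1r.
move: e0 h2 h3; rewrite /eps mulrBr mulr1 => e0 h2 h3.
by apply/andP; split; lra.
Qed.

Let a k u := `|nu k u|.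

(** Tightness uniform in [k]: [c * stationary u - a k u] is nonnegative and admissible, so its mass
    grows with the length, and [a k] gains no more mass than [c * stationary] does. *)
Lemma lsum_a_tail k N m : lsum N (a k) <= lsum m (a k) + c * eps m.
Proof.
have aa : admissible (a k) by apply/admissible_abs/admissible_nu.
have a0 u : 0 <= a k u by exact: normr_ge0.
have c0 : 0 <= c by rewrite addr_ge0.
have [Nm|/ltnW mN] := leqP N m.
  by rewrite (le_trans (lsum_homo aa a0 Nm)) // lerDl mulr_ge0 // eps_ge0.
have ad : admissible (fun u => c * stationary u - a k u).
  by apply: admissible_sub => //; apply/admissible_scale/admissible_stationary.
have ge u : 0 <= c * stationary u - a k u by rewrite subr_ge0 nu_le.
have := lsum_homo ad ge mN; rewrite !lsum_sub !lsum_scale /eps.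
have := ler_wpM2l c0 (eps_ge0 N); rewrite mulr0 /eps !mulrBr; lra.
Qed.

(** The full [l^1] distance after [k] deletions: the masses increase with [N], so the supremum is
    their limit. *)
Let L k := sup (range (fun N => lsum N (a k))).

Lemma L_ge k N : lsum N (a k) <= L k.
Proof.
apply: sup_upper_bound; last by exists N.
split; first by exists (lsum 0 (a k)); exists 0%N.
by exists (lsum 0 (a k) + c * eps 0) => _ [m _ <-]; apply: lsum_a_tail.
Qed.

Lemma L_le k b : (forall N, lsum N (a k) <= b) -> L k <= b.
Proof.
move=> h; apply: ge_sup; first by exists (lsum 0 (a k)); exists 0%N.
by move=> _ [N _ <-].
Qed.

Lemma L_contract k m :
  L (m + k) + sn 0 ^+ m * n%:R^-1 ^+ n * (lsum m (a k) - `|lsum m (nu k)|) <= L k.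
Proof.
rewrite -lerBrDr; apply: L_le => N; rewrite lerBrDr.
have nuE : iter m del_op (nu k) = nu (m + k).
  by rewrite /nu iter_del_sub iter_del_stationary iterD.
have := lsum_contract m (admissible_nu k) (leq_maxr N n); rewrite nuE.
move=> /le_trans /(_ (L_ge k _)); apply: le_trans; rewrite lerD2r.
apply: lsum_homo; [exact/admissible_abs/admissible_nu|by move=> u; exact: normr_ge0|exact: leq_maxl].
Qed.

Lemma L_cvg0 : L @ \oo --> (0 : R).
Proof.
have L0 k : 0 <= L k.
  apply: le_trans (L_ge k 0); rewrite /lsum big_words0; exact: normr_ge0.
have Lc : cvgn L.
  apply: nonincreasing_is_cvgn; last by exists 0 => _ [k _ <-].
  apply/nonincreasing_seqP => k; apply: le_trans (L_contract k 1); rewrite lerDl.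
  rewrite mulr_ge0 ?mulr_ge0 ?exprn_ge0 ?sn_ge0 ?invr_ge0 // subr_ge0.
  exact: ler_norm_sum.
set l := limn L; have Ll : L @ \oo --> l by [].
have l0 : 0 <= l by apply: limr_ge => //; apply: nearW.
(* With [m] fixed, [eta] is fixed, and letting [k] tend to infinity in [key] leaves
   [eta * (l - (c + c) * eps m) <= 0]. Only afterwards does [m] tend to infinity. *)
have lm m : l <= (c + c) * eps m.
  set eta := sn 0 ^+ m * n%:R^-1 ^+ n.
  have eta0 : 0 < eta by rewrite mulr_gt0 ?exprn_gt0 ?sn0_gt0 ?invr_gt0.
  have key k : L (k + m)%N + eta * (L k - (c + c) * eps m) <= L k.
    rewrite addnC; apply: le_trans (L_contract k m); rewrite lerD2l ler_wpM2l ?(ltW eta0) //.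
    have := lsum_nu_le k m; have := @L_le k _ (fun N => lsum_a_tail k N m).
    rewrite [(c + c) * _]mulrDl.
    move: (L k) (lsum m (a k)) (c * eps m) `|lsum m (nu k)| => x1 x2 x3 x4; lra.
  have : l + eta * (l - (c + c) * eps m) <= l.
    apply: (@ler_cvg_to _ _ _ _ (fun k => L (k + m)%N + eta * (L k - (c + c) * eps m)) L _ _ _ Ll).
      apply: cvgD; first by rewrite (cvg_shiftn m L).
      by apply: cvgM; [exact: cvg_cst|apply: cvgB => //; exact: cvg_cst].
    exact: nearW.
  by rewrite gerDl pmulr_rle0 // subr_le0.
suff : l <= 0 by move=> l1; rewrite (_ : 0 = l) //; apply/eqP; rewrite eq_le l0 l1.
apply: (@ler_cvg_to _ _ _ _ (fun=> l) (fun m => (c + c) * eps m) l 0 (cvg_cst _ (F := \oo))).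
- rewrite -[X in _ --> X](mulr0 (c + c)) -[X in _ * X](subrr 1).
  apply: cvgM; first exact: cvg_cst.
  by apply: cvgB; [exact: cvg_cst|exact: lsum_stationary_cvg].
- exact: nearW.
Qed.

Lemma iter_del_cvg u : (fun k => iter k del_op g u) @ \oo --> stationary u.
Proof.
apply/cvgrPdist_le => e e0; have /cvgrPdist_le /(_ e e0) [N _ H] := L_cvg0.
exists N => // k /= /H /=; rewrite sub0r normrN distrC => h.
apply: le_trans (le_trans (ler_norm _) h); apply: le_trans (L_ge k (size u)).
by apply: (@lsum_ge _ (a k)) => // z; exact: normr_ge0.
Qed.

(** The missing mass is [eps m] minus the signed mass of the difference, hence at most
    [(c + 1) * eps m]. *)
Lemma lsum_iter_del_cvg k : (fun N => lsum N (iter k del_op g)) @ \oo --> (1 : R).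
Proof.
apply/cvgrPdist_le => e e0.
have : (fun N => (c + 1) * eps N) @ \oo --> (0 : R).
  rewrite -[X in _ --> X](mulr0 (c + 1)) -[X in _ * X](subrr 1).
  apply: cvgM; first exact: cvg_cst.
  by apply: cvgB; [exact: cvg_cst|exact: lsum_stationary_cvg].
move=> /cvgrPdist_le /(_ e e0) [N _ H]; exists N => // m /= /H /=.
rewrite sub0r normrN => /(le_trans (ler_norm _)); apply: le_trans.
have -> : 1 - lsum m (iter k del_op g) = eps m - lsum m (nu k).
  by rewrite /eps /nu lsum_sub; ring.
apply: le_trans (ler_normB _ _) _; rewrite mulrDl mul1r addrC (ger0_norm (eps_ge0 m)).
by rewrite lerD2r lsum_nu_le.
Qed.

End Convergence.

(** A repeated letter weighs [1 / (n * t k) >= 1 / n] because [t k <= 1], and each of the [n - #|s|]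
    new letters weighs [1] instead of [1 / n]. *)
Lemma word_wt_lb s u : covers s u -> n%:R^-1 ^+ size u <= n%:R^-1 ^+ (n - #|s|) * word_wt s u.
Proof.
elim: u s => [|x u IH] s /=.
  by rewrite covers_nil => /eqP->; rewrite cardsT card_ord subnn mulr1.
rewrite covers_cons => /IH h; case: ifP => xs.
  move: h; rewrite (finset.setUidPr _) ?finset.sub1set // => h.
  rewrite exprS mulrCA ler_pM ?exprn_ge0 ?invr_ge0 //.
  rewrite lef_pV2 ?posrE ?mulr_gt0 ?t_gt0 //; last by apply/card_gt0P; exists x.
  by rewrite ger_pMr.
move: h; rewrite cardsU1 xs add1n mul1r => h.
have sn' : (#|s| < n)%N.
  have := subset_leq_card (finset.subsetT (x |: s)).
  by rewrite cardsU1 xs add1n cardsT card_ord.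
by rewrite -(subnSK sn') !exprS -mulrA ler_wpM2l ?invr_ge0.
Qed.

Definition initial u : R := if full u then n%:R^-1 ^+ size u else 0.

Lemma initial_le u : initial u <= n%:R^-1 ^+ n / norm_cst * stationary u.
Proof.
rewrite /initial /stationary; case: ifP => fu; last by rewrite mulr0.
by have := word_wt_lb fu; rewrite cards0 subn0 mulrA divfK // gt_eqF ?norm_cst_gt0.
Qed.

Lemma admissible_initial : admissible initial.
Proof.
split=> [u x fu|u /negPf fu]; rewrite /initial; last by rewrite fu.
rewrite fu (full_sub _ fu) => [|z zu]; last by rewrite mem_rcons inE zu orbT.
by rewrite size_rcons exprSr.
Qed.

Lemma initial_ge0 u : 0 <= initial u.
Proof. by rewrite /initial; case: ifP => // _; rewrite exprn_ge0 ?invr_ge0. Qed.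

End Chain.

(** Uniform letters are stationary for the rule that always deletes the minimum, that is for
    [t k = 1] when [k > 0], so [lsum_stationary_cvg] applies to that [t]. *)
Lemma lsum_initial_cvg (R : realType) (n : nat) : (0 < n)%N ->
  (fun N => lsum N (@initial R n)) @ \oo --> (1 : R).
Proof.
move=> n0; pose t (k : nat) : R := (0 < k)%N%:R.
have nR0 : n%:R != 0 :> R by rewrite pnatr_eq0 -lt0n.
have -> : @initial R n = stationary t; last first.
  apply: lsum_stationary_cvg => //.
  - by move=> [|k]; rewrite /t //= ler01.
  - by rewrite /t n0.
  - move=> k /andP[k0 kn]; rewrite /t k0 ltr_pdivrMr ?ltr0n // mul1r ltr_nat //.
apply/funext => u; rewrite /initial /stationary; case: ifP => // fu.
have -> : norm_cst n t = n%:R^-1 ^+ n.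
  rewrite /norm_cst big_mkord -[X in _ ^+ X](card_ord n) -prodr_const; apply: eq_bigr => k _.
  have nk : (n - k)%:R != 0 :> R by rewrite pnatr_eq0 -lt0n subn_gt0.
  have -> : gap_ratio n t k = k%:R / n%:R.
    by rewrite /gap_ratio /t; case: (nat_of_ord k) => [|j]; rewrite ?mul0r ?mulr1.
  move: nk; rewrite natrB; last exact: ltnW.
  by move=> nk; field; rewrite nR0.
suff: forall s, covers s u -> n%:R^-1 ^+ size u = n%:R^-1 ^+ (n - #|s|) * word_wt t s u.
  by move/(_ _ fu); rewrite cards0 subn0.
elim: u {fu} => [|x u IH] s /=.
  by rewrite covers_nil => /eqP->; rewrite cardsT card_ord subnn mulr1.
rewrite covers_cons => /IH h; rewrite exprS h; case: ifP => xs.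
  rewrite (finset.setUidPr _) ?finset.sub1set // mulrCA /t; congr (_ * _).
  have -> : (0 < #|s|)%N by apply/card_gt0P; exists x.
  by rewrite mulr1.
rewrite cardsU1 xs add1n mul1r.
have sn' : (#|s| < n)%N.
  have := subset_leq_card (finset.subsetT (x |: s)).
  by rewrite cardsU1 xs add1n cardsT card_ord.
by rewrite -[in RHS](subnSK sn') exprS -mulrA.
Qed.

(** * Deletions on words *)

Section Deletion.
Variable n : nat.
Implicit Types (s : {set 'I_n}) (u y w : seq 'I_n) (x l : 'I_n).

(** The label [c] is absolute: the letters of [s] use up the labels below [#|s|], and the next new
    letter has label [#|s|]. *)
Fixpoint del s (c : nat) y : seq 'I_n :=
  if y is x :: y' then
    if x \in s then x :: del s c y'
    else if c == #|s| then y' else x :: del (x |: s) c y'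
  else [::].

Fixpoint first_marks s u : seq bool :=
  if u is x :: u' then (x \notin s) :: first_marks (x |: s) u' else [::].

Lemma size_bits s u : size (first_marks s u) = size u.
Proof. by elim: u s => //= x u IH s; rewrite IH. Qed.

Lemma setU1_in s x : x \in s -> x |: s = s.
Proof. by move=> xs; apply: finset.setUidPr; rewrite finset.sub1set. Qed.

Lemma count_bits s u : (count id (first_marks s u) + #|s| == n)%N = covers s u.
Proof.
elim: u s => [|x u IH] s /=.
  have := eqEcard s setT; rewrite finset.subsetT cardsT card_ord add0n covers_nil => ->.
  by rewrite eqn_leq; have := max_card (mem s); rewrite card_ord => ->.
by rewrite covers_cons -IH cardsU1 [in LHS]addnAC addnC addnA.
Qed.

Lemma bits_cat s u y : covers s u -> first_marks s (u ++ y) = first_marks s u ++ nseq (size y) false.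
Proof.
elim: u s => [|x u IH] s /=; last by rewrite covers_cons => /IH ->.
rewrite covers_nil => /eqP->; elim: y => //= x y IH.
by rewrite -IH finset.in_setT setU1_in // ?finset.in_setT.
Qed.

Lemma del_subseq s c y : subseq (del s c y) y.
Proof.
elim: y s => //= x y IH s; case: ifP => _; first by rewrite eqxx.
by case: ifP => _; [exact: subseq_cons|rewrite eqxx].
Qed.

Lemma preds_ge s l u e : e \in preds s l u -> (#|s| <= e.1)%N.
Proof.
elim: u s e => [|x u IH] s e /=; first by rewrite inE => /eqP->.
rewrite inE => /orP[/eqP-> //|]; case: eqP => // _ /mapP[e' /IH h ->] /=.
by apply: leq_trans h; rewrite cardsU1 leq_addl.
Qed.

Lemma preds_lt s l u e : l \notin s -> e \in preds s l u -> (e.1 < n)%N.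
Proof.
have small s' : l \notin s' -> (#|s'| < n)%N.
  move=> ls; have := @proper_card _ (mem s') (mem setT); rewrite cardsT card_ord; apply.
  rewrite finset.properEneq finset.subsetT andbT.
  by apply: contraNneq ls => ->; rewrite finset.in_setT.
elim: u s e => [|x u IH] s e ls /=; first by rewrite inE => /eqP->; apply: small.
rewrite inE => /orP[/eqP-> |]; first exact: small.
case: eqP => // /eqP nxl /mapP[e' /IH h ->] /=; apply: h.
by rewrite !inE negb_or eq_sym nxl.
Qed.

Lemma sum_preds_cons s l z u c x y :
  (\sum_(e <- preds (z |: s) l u) ((e.1 == c) && prefix (z :: e.2) (x :: y) : nat))%N
  = ((z == x) * \sum_(e <- preds (z |: s) l u) ((e.1 == c) && prefix e.2 y : nat))%N.
Proof.
rewrite big_distrr; apply: eq_bigr => e _ /=.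
by case: (z == x); rewrite ?mul1n ?mul0n ?andbF.
Qed.

(** Equating a Boolean with a sum of Booleans gives existence and uniqueness of the matching
    predecessor at once; it later becomes additivity over disjoint events. *)
Lemma prefix_del s c y u : covers s u -> (#|s| <= c < n)%N ->
  prefix u (del s c y) =
  (\sum_(l | l \notin s) \sum_(e <- preds s l u) ((e.1 == c) && prefix e.2 y : nat))%N :> nat.
Proof.
elim: y s u => [|x y IH] s u cu /andP[sc cn].
  rewrite big1 => [|l _].
    case: u cu => //; rewrite covers_nil => /eqP sT.
    by move: sc; rewrite sT cardsT card_ord leqNgt cn.
  rewrite big1_seq // => e /andP[_ /preds_perm /perm_size].
  by case: (e.2) => //=; rewrite andbF.
case: u cu => [|z u].
  rewrite covers_nil => /eqP sT.
  by move: sc; rewrite sT cardsT card_ord leqNgt cn.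
rewrite covers_cons => cu.
rewrite (eq_bigr (fun l => ((#|s| == c) && (l == x) && prefix (z :: u) y : nat)
   + (z != l) * ((z == x) * \sum_(e <- preds (z |: s) l u) ((e.1 == c) && prefix e.2 y : nat)))%N); last first.
  move=> l _; rewrite [preds _ _ _]/= big_cons -sum_preds_cons; congr (_ + _)%N.
    by rewrite /= andbA.
  by case: (eqVneq z l) => [_|_]; rewrite ?big_nil // mul1n big_map.
have tail : (\sum_(l | l \notin s) (z != l) *
    ((z == x) * \sum_(e <- preds (z |: s) l u) ((e.1 == c) && prefix e.2 y : nat)) =
   (z == x) * \sum_(l | l \notin z |: s) \sum_(e <- preds (z |: s) l u) ((e.1 == c) && prefix e.2 y : nat))%N.
  rewrite big_distrr /= big_mkcond [RHS]big_mkcond; apply: eq_bigr => l _.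
  rewrite !inE [l == z]eq_sym; case: (z == l); rewrite ?mul0n ?mul1n /=; first by case: ifP.
  by [].
(* If [x] is an old letter it cannot be the inserted one, so only the tail terms survive. *)
rewrite big_split /= tail; case: (boolP (x \in s)) => xs.
  rewrite big1 ?add0n => [|l ls]; last first.
    by case: (eqVneq l x) => [lx|_]; [move: ls; rewrite lx xs|rewrite andbF].
  rewrite prefix_cons; case: (eqVneq z x) => [zx|//]; rewrite mul1n zx setU1_in //.
  by move: cu; rewrite zx setU1_in // => cu; apply: IH; rewrite ?sc.
(* If [x] is the erased letter, only the insertion in front with [l = x] counts: insertions behind
   [x] have index above [#|s|]. *)
case: (eqVneq c #|s|) => [cs|ncs].
  rewrite cs (bigD1 x) //= ?eqxx big1 ?addn0 => [|l /andP[_ /negPf->]] //.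
  case: (eqVneq z x) => [zx|_]; rewrite ?mul0n ?addn0 // mul1n zx.
  rewrite big1 ?addn0 // => l _; rewrite big1_seq // => e /andP[_ /preds_ge].
  by rewrite cardsU1 xs add1n; case: eqP => // ->; rewrite ltnn.
rewrite big1 ?add0n => [|l _]; last by rewrite andFb.
rewrite prefix_cons; case: (eqVneq z x) => [zx|//]; rewrite mul1n zx; move: cu; rewrite zx => cu.
by apply: IH => //; rewrite cardsU1 xs add1n cn ltn_neqAle eq_sym ncs sc.
Qed.

Definition allpreds u := flatten [seq preds set0 l u | l <- enum 'I_n].

Lemma big_allpreds (V : nmodType) u (F : nat * seq 'I_n -> V) :
  \sum_(e <- allpreds u) F e = \sum_l \sum_(e <- preds set0 l u) F e.
Proof. by rewrite big_flatten big_map big_enum. Qed.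

Lemma prefix_del_all c y u : full u -> (c < n)%N ->
  prefix u (del set0 c y)
  = (\sum_(e <- allpreds u) ((e.1 == c) && prefix e.2 y : nat))%N :> nat.
Proof.
move=> fu cn; rewrite (prefix_del y fu) ?cards0 // /allpreds big_flatten big_map big_enum /=.
by apply: eq_bigl => l; rewrite finset.in_set0.
Qed.

Fixpoint true_pos (p : nat) (b : seq bool) : seq nat :=
  if b is x :: b' then if x then p :: true_pos p.+1 b' else true_pos p.+1 b' else [::].

Lemma size_true_pos p b : size (true_pos p b) = count id b.
Proof. by elim: b p => //= -[] b IH p /=; rewrite IH. Qed.

Lemma true_pos_nseq p b m : true_pos p (nseq m false ++ b) = true_pos (p + m) b.
Proof. by elim: m p => [|m IH] p /=; rewrite ?addn0 // IH addSnnS. Qed.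

Lemma true_pos_cat_nseq p b m : true_pos p (b ++ nseq m false) = true_pos p b.
Proof.
elim: b p => [|[] b IH] p /=; rewrite ?IH //.
by elim: m p => //= m IH p.
Qed.

Lemma mem_true_pos p b k : k \in true_pos p b -> (p <= k < p + size b)%N.
Proof.
elim: b p => // x b IH p /=; have H : k \in true_pos p.+1 b -> (p <= k < p + (size b).+1)%N.
  by move/IH; rewrite addSnnS => /andP[/ltnW -> ->].
case: x => //; rewrite inE => /orP[/eqP->|//].
by rewrite leqnn -[X in (X < _)%N]addn0 ltn_add2l.
Qed.

Lemma true_pos_sorted p b : sorted ltn (true_pos p b).
Proof.
elim: b p => //= -[] b IH p //=; rewrite path_sortedE; last exact: ltn_trans.
by rewrite IH andbT; apply/allP => k /mem_true_pos /andP[].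
Qed.

Lemma true_pos_inj p b b' : size b = size b' -> true_pos p b = true_pos p b' -> b = b'.
Proof.
elim: b b' p => [|x b IH] [|x' b'] p //= [sz].
have no b1 : p \notin true_pos p.+1 b1 by apply/negP => /mem_true_pos; rewrite ltnn.
case: x; case: x'.
- by case=> /IH ->.
- by move=> h; have := no b'; rewrite -h mem_head.
- by move=> h; have := no b; rewrite h mem_head.
- by move/IH ->.
Qed.

Lemma mask_true_pos b (r : seq nat) p : (p + size b <= size r)%N ->
  mask b (drop p r) = [seq nth 0%N r k | k <- true_pos p b].
Proof.
elim: b p => [|x b IH] p; first by rewrite mask0s.
move=> /= h; have pr : (p < size r)%N by apply: leq_trans h; rewrite addnS ltnS leq_addr.
by rewrite (drop_nth 0%N pr); case: x => /=; rewrite IH // addSnnS.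
Qed.

End Deletion.

(** * The MultiQueue seen through a window *)

Section Windows.
Variable n : nat.
Implicit Types (a : nat -> 'I_n) (D r : seq nat) (s : {set 'I_n}) (u : seq 'I_n).

(* Everything is observed through the finite window of the elements below H; a word
   prefix of length N after s deletions is decided as soon as N + s <= H. *)
Definition rest (H : nat) D : seq nat := [seq k <- iota 0 H | k \notin D].
Definition firsts a s r : seq nat := mask (first_marks s (map a r)) r.

Lemma rest_sorted H D : sorted ltn (rest H D).
Proof. by apply: sorted_filter; [exact: ltn_trans|exact: iota_ltn_sorted]. Qed.

Lemma rest_uniq H D : uniq (rest H D).
Proof. by rewrite filter_uniq // iota_uniq. Qed.

Lemma mem_rest H D k : (k \in rest H D) = (k < H)%N && (k \notin D).
Proof. by rewrite mem_filter mem_iota add0n andbC. Qed.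

Lemma size_rest H D : (H <= size (rest H D) + size D)%N.
Proof.
rewrite -{1}(size_iota 0 H) -(count_predC (mem D) (iota 0 H)) addnC leq_add //.
  by rewrite size_filter.
rewrite -size_filter uniq_leq_size ?filter_uniq ?iota_uniq // => k.
by rewrite mem_filter => /andP[].
Qed.

Lemma firsts_cons a s k r :
  firsts a s (k :: r) = nseq (a k \notin s) k ++ firsts a (a k |: s) r.
Proof. by rewrite /firsts /=; case: (a k \notin s). Qed.

(** [firsts] skips the letters of [s], which the label [c] counts; hence the shift by [#|s|]. *)
Lemma map_rem_firsts a s c r : uniq r -> (#|s| <= c)%N ->
  (c - #|s| < size (firsts a s r))%N ->
  map a (rem (nth 0%N (firsts a s r) (c - #|s|)) r) = del s c (map a r).
Proof.
elim: r s => [|k r IH] s //= /andP[kr ur] sc.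
have tl i s' : (i < size (firsts a s' r))%N -> k != nth 0%N (firsts a s' r) i.
  move=> h; apply: contraNneq kr => ->; apply: (@mem_mask _ _ (first_marks s' (map a r))).
  exact: mem_nth.
rewrite firsts_cons; case: (boolP (a k \in s)) => ks /=.
  by rewrite setU1_in // => h; rewrite (negPf (tl _ _ h)) /= IH.
case: (eqVneq c #|s|) => [->|ncs]; first by rewrite subnn eqxx.
have sc' : (#|s| < c)%N by rewrite ltn_neqAle eq_sym ncs sc.
have cE : (c - #|s| = (c - #|a k |: s|).+1)%N by rewrite cardsU1 ks add1n subnSK.
rewrite cE /= ltnS => h; rewrite (negPf (tl _ _ h)) /= IH // cardsU1 ks add1n //.
Qed.

Lemma mem_firsts a s r k : sorted ltn r ->
  (k \in firsts a s r) <->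
  [/\ k \in r, a k \notin s & forall k', k' \in r -> (k' < k)%N -> a k' != a k].
Proof.
elim: r s => [|z r IH] s /=; first by rewrite /firsts /=; split => [|[]].
rewrite path_sortedE; last exact: ltn_trans.
move=> /andP[/allP zr /(IH (a z |: s)) {}IH].
rewrite firsts_cons mem_cat mem_nseq lt0b; split.
- case/orP => [/andP[azs /eqP->]|/IH[kr]].
    split; rewrite ?mem_head // => k'; rewrite inE => /orP[/eqP->|/zr h]; first by rewrite ltnn.
    by move=> h'; have := ltn_trans h h'; rewrite ltnn.
  rewrite !inE negb_or => /andP[kz ks] h; split; rewrite ?kr ?orbT //.
  move=> k'; rewrite inE => /orP[/eqP-> _|]; [by rewrite eq_sym|exact: h].
- case; rewrite inE => /orP[/eqP->|kr] ks h; first by rewrite ks eqxx.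
  apply/orP; right; apply/IH; split => //; last first.
    by move=> k' k'r; apply: h; rewrite inE k'r orbT.
  by rewrite !inE negb_or ks andbT eq_sym; apply: h; [exact: mem_head|exact: zr].
Qed.

Lemma qtopP a D j t : qtop a D j = Some t <->
  [/\ a t = j, t \notin D & forall k, (k < t)%N -> k \notin D -> a k != j].
Proof.
rewrite /qtop; case: pselect => [ex|nex]; last first.
  by split=> // -[aj tD _]; case: nex; exists t; rewrite aj eqxx.
case: ex_minnP => m /andP[/eqP am mD] mmin; split.
  move=> [<-]; split=> // k km kD; apply/negP => /eqP akj.
  by have := mmin k; rewrite akj eqxx kD leqNgt km => /(_ isT).
move=> [atj tD h]; congr Some; apply/eqP; rewrite eqn_leq mmin ?atj ?eqxx //=.
by rewrite leqNgt; apply/negP => mt; have := h _ mt mD; rewrite am eqxx.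
Qed.

Lemma mem_tops a D t :
  (t \in tops a D) <-> (t \notin D /\ forall k, (k < t)%N -> k \notin D -> a k != a t).
Proof.
rewrite /tops mem_sort mem_pmap; split.
  by move=> /mapP[j _ /esym/qtopP[<- tD h]].
by move=> [tD h]; apply/mapP; exists (a t); rewrite ?mem_enum //; apply/esym/qtopP.
Qed.

Lemma tops_sorted a D : sorted ltn (tops a D).
Proof.
rewrite ltn_sorted_uniq_leq /tops sort_uniq sort_sorted ?andbT; last exact: leq_total.
apply: (@pmap_uniq _ _ _ (fun t => a t)); last exact: enum_uniq.
move=> j /=; case E: (qtop a D j) => [t|//] /=.
by case/qtopP: E => ->.
Qed.

Lemma size_tops a D : (size (tops a D) <= n)%N.
Proof.
by rewrite /tops size_sort size_pmap (leq_trans (count_size _ _)) // size_enum_ord.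
Qed.

Lemma size_true_pos_full u : full u -> size (true_pos 0 (first_marks set0 u)) = n.
Proof. by rewrite /full -count_bits cards0 addn0 size_true_pos => /eqP. Qed.

Lemma size_firsts a r : full (map a r) -> size (firsts a set0 r) = n.
Proof.
by move=> /size_true_pos_full h; rewrite size_mask -?(size_true_pos 0) // size_bits size_map.
Qed.

Lemma firsts_tops a H D : {subset firsts a set0 (rest H D) <= tops a D}.
Proof.
move=> t /(mem_firsts _ _ _ (rest_sorted H D)) [tr _ h]; apply/mem_tops.
move: tr; rewrite mem_rest => /andP[tH tD]; split=> // k kt kD.
by apply: h => //; rewrite mem_rest kD (ltn_trans kt tH).
Qed.

(** First occurrences in the window are tops; a full window shows [n] of them and there are at most
    [n] tops, so the two sorted lists agree. *)
Lemma tops_full a H D : full (map a (rest H D)) -> tops a D = firsts a set0 (rest H D).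
Proof.
move=> f.
have ss : sorted ltn (firsts a set0 (rest H D)).
  by apply: sorted_mask; [exact: ltn_trans|exact: rest_sorted].
apply: (irr_sorted_eq ltn_trans ltnn (tops_sorted a D) ss) => t.
have [] := @uniq_min_size _ (firsts a set0 (rest H D)) (tops a D).
- by rewrite mask_uniq // rest_uniq.
- exact: firsts_tops.
- by rewrite size_firsts // size_tops.
by move=> _ ->.
Qed.

Lemma rank_rest H D p : (p < size (rest H D))%N ->
  rank_in D (nth 0%N (rest H D) p) = p.+1.
Proof.
move=> pr; set x := nth _ _ _; have := mem_nth 0%N pr; rewrite -/x mem_rest => /andP[xH xD].
congr _.+1; rewrite -size_filter -/(rest x D).
have rE : rest H D = rest x D ++ x :: [seq k <- iota x.+1 (H - x.+1) | k \notin D].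
  rewrite /rest -{1}(subnKC (ltnW xH)) iotaD filter_cat add0n; congr (_ ++ _).
  by rewrite -(subnSK xH) /= xD.
have : index x (rest H D) = p by rewrite index_uniq // rest_uniq.
rewrite rE index_cat; case: ifP => [|_]; first by rewrite mem_rest ltnn.
by rewrite /= eqxx addn0.
Qed.

Lemma mq_rank_full a c H (s : nat) i : let D := mq_removed a c s in
  full (map a (rest H D)) ->
  mq_rank a c s i = (nth 0%N (true_pos 0 (first_marks set0 (map a (rest H D)))) i).+1.
Proof.
move=> D f; set b := first_marks _ _.
have sb : size b = size (rest H D) by rewrite size_bits size_map.
have st : size (true_pos 0 b) = n by rewrite size_true_pos_full.
rewrite /mq_rank -/D (tops_full f) size_firsts // ltn_ord /firsts.
rewrite -[X in mask _ X]drop0 mask_true_pos ?sb // (nth_map 0%N) ?st //.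
rewrite rank_rest // -sb; have : nth 0%N (true_pos 0 b) i \in true_pos 0 b by rewrite mem_nth ?st.
by move/mem_true_pos.
Qed.

Lemma mq_rank_prefix a c H (s : nat) u i : full u ->
  prefix u (map a (rest H (mq_removed a c s))) ->
  mq_rank a c s i = (nth 0%N (true_pos 0 (first_marks set0 u)) i).+1.
Proof.
move=> fu /prefixP[y yE].
rewrite (@mq_rank_full _ _ H) yE; last by apply: full_sub fu => x xu; rewrite mem_cat xu.
by rewrite bits_cat // true_pos_cat_nseq.
Qed.

(** Positive ranks exclude empty queues, and ranks at most [N] place every top among the first [N]
    remaining elements. *)
Lemma mq_rank_full_take a c H (s : nat) (N : nat) :
  (forall i : 'I_n, 0 < mq_rank a c s i <= N)%N ->
  (N <= size (rest H (mq_removed a c s)))%N ->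
  full (take N (map a (rest H (mq_removed a c s)))).
Proof.
rewrite /mq_rank; set D := mq_removed a c s => rk NR.
apply/fullP => j.
have n0 : (0 < n)%N by apply: leq_ltn_trans (ltn_ord j).
(* A positive rank at the last label rules out the junk value [0], so all [n] tops exist. *)
have st : size (tops a D) = n.
  apply/eqP; rewrite eqn_leq size_tops /=.
  have lt : (n.-1 < n)%N by rewrite prednK.
  by have := rk (Ordinal lt); case: ifP => //=; rewrite prednK.
have /allP /(_ j) : all [eta qtop a D] (enum 'I_n).
  by rewrite all_count size_enum_ord -size_pmap -(size_sort leq) -/(tops a D) st.
rewrite mem_enum => /(_ isT); case E: (qtop a D j) => [t|//] _.
have /qtopP[atj tD ht] := E.
have tt : t \in tops a D by apply/mem_tops; split => // k; rewrite atj; apply: ht.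
have it : (index t (tops a D) < n)%N by move: tt; rewrite -index_mem st.
have := rk (Ordinal it); rewrite /= st it nth_index // => /andP[_].
rewrite /rank_in -size_filter => rN.
(* A top outside the window would be preceded by all of its at least [N] elements, so its rank would
   exceed [N]. *)
have tH : (t < H)%N.
  rewrite ltnNge; apply/negP => Ht; move: rN; apply/negP; rewrite -leqNgt.
  apply: leq_trans NR _; rewrite /rest -(subnKC Ht) iotaD filter_cat size_cat leq_addr //.
rewrite -map_take -atj; apply: map_f; rewrite in_take ?mem_rest ?tH ?tD //.
have tR : t \in rest H D by rewrite mem_rest tH.
have := tR; rewrite -index_mem => /rank_rest; rewrite nth_index // /rank_in -size_filter.
by move=> [<-].
Qed.

Lemma rest_cons H D t : rest H (t :: D) = rem t (rest H D).
Proof.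
rewrite rem_filter ?rest_uniq // /rest -filter_predI; apply: eq_filter => k.
by rewrite /= inE negb_or.
Qed.

(** If the window shows all letters, the deleted top lies in it and the step is [del]. Otherwise
    both words are subsequences of a word missing a letter, and neither can start with the full
    [u]. *)
Lemma prefix_mq_step a H D (c : 'I_n) u : full u ->
  prefix u (map a (rest H (mq_step a D c))) = prefix u (del set0 c (map a (rest H D))).
Proof.
move=> fu; case: (boolP (full (map a (rest H D)))) => [f|nf].
  rewrite /mq_step (tops_full f) size_firsts // ltn_ord rest_cons.
  by rewrite -map_rem_firsts ?rest_uniq ?cards0 // subn0 ?size_firsts.
have no y : subseq y (map a (rest H D)) -> prefix u y = false.
  move=> sy; apply/negP => /prefixP[z yE]; move/negP: nf; apply.
  apply: full_sub fu => x xu; apply: (mem_subseq sy).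
  by rewrite yE mem_cat xu.
rewrite !no // ?del_subseq //; apply: map_subseq.
rewrite /mq_step; case: ifP => _; rewrite ?rest_cons //; exact: rem_subseq.
Qed.

Lemma size_mq_removed a c (s : nat) : (size (mq_removed a c s) <= s)%N.
Proof.
elim: s => //= s IH; rewrite /mq_step; case: ifP => _ //=; exact: leqW.
Qed.

(* The marks of a minimal full word whose first occurrences are separated by ds. *)
Definition gap_bits (ds : seq nat) : seq bool :=
  true :: flatten [seq rcons (nseq d.-1 false) true | d <- ds].

Lemma size_gap_bits ds : all (ltn 0) ds -> size (gap_bits ds) = (sumn ds).+1.
Proof.
rewrite /=; move=> h; congr _.+1; elim: ds h => //= d ds IH /andP[d0 /IH <-].
by rewrite size_cat size_rcons size_nseq prednK.
Qed.

Lemma true_pos_gap_bits ds : all (ltn 0) ds ->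
  true_pos 0 (gap_bits ds) = [seq sumn (take i ds) | i <- iota 0 (size ds).+1].
Proof.
move=> h; rewrite /= take0 /=; congr (_ :: _).
have E m : iota 1 m = [seq i.+1 | i <- iota 0 m] by rewrite -(iotaDl 1).
rewrite E -map_comp.
suff : forall p, true_pos p.+1 (flatten [seq rcons (nseq d.-1 false) true | d <- ds])
  = [seq (p + sumn (take i.+1 ds))%N | i <- iota 0 (size ds)] by move->.
elim: ds h => //= d ds IH /andP[d0 hds] p.
rewrite -cats1 -catA true_pos_nseq /= addSnnS prednK // IH // take0 /= addn0; congr (_ :: _).
by rewrite E -map_comp; apply: eq_map => i /=; rewrite addnA.
Qed.

(** Ranks are first-occurrence positions plus one, and these positions determine the marks. The last
    rank is [(sumn ds).+1], so prefixes of that length decide the event. *)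
Lemma mq_rank_gap_bits a c H (s : nat) ds : n = (size ds).+1 -> all (ltn 0) ds ->
  ((sumn ds).+1 + s <= H)%N ->
  (forall i : 'I_n, mq_rank a c s i = (sumn (take i ds)).+1) <->
  exists2 u, first_marks set0 u = gap_bits ds & prefix u (map a (rest H (mq_removed a c s))).
Proof.
move=> nE ds0 HH; set N := (sumn ds).+1.
have tpi (i : 'I_n) : nth 0%N (true_pos 0 (gap_bits ds)) i = sumn (take i ds).
  rewrite true_pos_gap_bits // (nth_map 0%N) ?nth_iota ?size_iota -?nE //.
split=> [rk|[u ub pu] i]; last first.
  rewrite (mq_rank_prefix _ _ pu) ?ub ?tpi //.
  by rewrite /full -count_bits cards0 addn0 ub -(size_true_pos 0) true_pos_gap_bits // size_map size_iota nE.
have NR : (N <= size (rest H (mq_removed a c s)))%N.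
  rewrite -(leq_add2r s); apply: leq_trans HH _; apply: leq_trans (size_rest H (mq_removed a c s)) _.
  by rewrite leq_add2l size_mq_removed.
set R := rest _ _ in NR *; set u := take N (map a R).
have fu : full u.
  apply: mq_rank_full_take => // i; rewrite rk /= ltnS -{2}(cat_take_drop i ds) sumn_cat leq_addr //.
have pu : prefix u (map a R) by apply/prefixP; exists (drop N (map a R)); rewrite cat_take_drop.
exists u => //; apply: (@true_pos_inj 0).
  by rewrite size_bits size_gap_bits // size_takel // size_map.
have szu := size_true_pos_full fu.
have szg : size (true_pos 0 (gap_bits ds)) = n by rewrite true_pos_gap_bits // size_map size_iota nE.
apply: (@eq_from_nth _ 0%N) => [|i]; rewrite szu ?szg // => ni.
have := mq_rank_prefix (Ordinal ni) fu pu; rewrite rk => -[/= <-].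
by rewrite (tpi (Ordinal ni)).
Qed.

End Windows.

(** * The stationary law of the gaps between first occurrences *)

Section GapSums.
Variables (R : realType) (n : nat) (t : nat -> R).
Hypothesis n_gt0 : (0 < n)%N.
Implicit Types (s : {set 'I_n}) (b : seq bool) (ds : seq nat).

(** After [k] distinct letters there are [n - k] new letters of weight [1] and [k] old ones of
    weight [1 / (n * t k)]. *)
Fixpoint bits_wt (k : nat) b : R :=
  if b is x :: b' then
    if x then (n - k)%:R * bits_wt k.+1 b' else gap_ratio n t k * bits_wt k b'
  else 1.

Lemma sum_bits_word_wt s b :
  \sum_(u <- words n (size b) | first_marks s u == b) word_wt t s u = bits_wt #|s| b.
Proof.
elim: b s => [|x b IH] s; first by rewrite big_mkcond big_words0 eqxx.
rewrite big_mkcond big_wordsS /=.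
rewrite (eq_bigr (fun z => if (z \notin s) == x then
    (if z \in s then (n%:R * t #|s|)^-1 else 1) * bits_wt #|z |: s| b else 0)); last first.
  move=> z _; rewrite -IH mulr_sumr [in RHS]big_mkcond /=.
  case: (boolP ((z \notin s) == x)) => zx; last first.
    by rewrite big1 // => u _; rewrite eqseq_cons (negPf zx).
  by apply: eq_bigr => u _; rewrite eqseq_cons zx.
rewrite -big_mkcond /=; case: x.
  rewrite (eq_bigl (fun z => z \notin s)) => [|z]; last by rewrite eqb_id.
  rewrite (eq_bigr (fun=> bits_wt #|s|.+1 b)); last first.
    by move=> z zs; rewrite cardsU1 zs add1n (negPf zs) mul1r.
  rewrite sumr_const -[LHS]mulr_natl; congr (_%:R * _); apply/esym.
  by rewrite -{1}(card_ord n) -(cardC (mem s)) addKn; apply: eq_card => z; rewrite !inE.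
rewrite (eq_bigl (fun z => z \in s)) => [|z]; last by rewrite eqbF_neg negbK.
rewrite (eq_bigr (fun=> (n%:R * t #|s|)^-1 * bits_wt #|s| b)); last first.
  by move=> z zs; rewrite setU1_in // zs.
by rewrite sumr_const -[LHS]mulr_natl mulrA.
Qed.

Lemma bits_wt_gaps k ds :
  bits_wt k (flatten [seq rcons (nseq d.-1 false) true | d <- ds])
  = \prod_(i < size ds) (gap_ratio n t (k + i) ^+ (nth 0%N ds i).-1 * (n - (k + i))%:R).
Proof.
elim: ds k => [|d ds IH] k /=; first by rewrite big_ord0.
rewrite big_ord_recl /= addn0.
have -> m b : bits_wt k (rcons (nseq m false) true ++ b)
    = gap_ratio n t k ^+ m * (n - k)%:R * bits_wt k.+1 b.
  by elim: m => [|m IHm] /=; rewrite ?IHm ?exprS ?mul1r ?mulrA.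
by rewrite IH; congr (_ * _); apply: eq_bigr => i _; rewrite /bump /= add1n addSnnS.
Qed.

(** A gap [d] after [k] distinct letters contains [d.-1] repeated letters, hence a factor
    [gap_ratio n t k ^+ d.-1]; the counts [n - k] cancel against [norm_cst] and geometric masses
    remain. *)
Lemma stationary_gap_bits ds : n = (size ds).+1 -> all (ltn 0%N) ds ->
  \sum_(u <- words n (size (gap_bits ds)) | first_marks set0 u == gap_bits ds) stationary t u
  = \prod_(j < size ds) geom1_pmf (1 - gap_ratio n t j.+1) (nth 0%N ds j).
Proof.
move=> nE ds0.
rewrite (eq_bigr (fun u => norm_cst n t * word_wt t set0 u)); last first.
  move=> u /eqP ub; rewrite /stationary -[full u]count_bits cards0 addn0 ub -(size_true_pos 0).
  have -> : size (true_pos 0 (gap_bits ds)) = n by rewrite true_pos_gap_bits // size_map size_iota.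
  by rewrite eqxx.
rewrite -mulr_sumr sum_bits_word_wt cards0 /= bits_wt_gaps /norm_cst big_mkord.
have -> : \prod_(k < n) ((1 - gap_ratio n t k) / (n - k)%:R)
  = n%:R^-1 * \prod_(j < size ds) ((1 - gap_ratio n t j.+1) / (n - j.+1)%:R).
  rewrite -(big_mkord xpredT (fun k => (1 - gap_ratio n t k) / (n - k)%:R)) [X in index_iota 0 X]nE.
  rewrite big_mkord big_ord_recl /= subn0 {1}/gap_ratio mul0r subr0 mul1r; congr (_ * _).
rewrite subn0 mulrACA mulVf ?mul1r ?pnatr_eq0 -?lt0n // -big_split /=.
apply: eq_bigr => j _; rewrite add1n /geom1_pmf subKr.
have -> : (nth 0%N ds j == 0%N) = false.
  by apply/negbTE; rewrite -lt0n; apply: (all_nthP 0%N ds0).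
have nj : (n - j.+1)%:R != 0 :> R by rewrite pnatr_eq0 -lt0n subn_gt0 nE ltnS.
by field.
Qed.

End GapSums.

(** * Probabilities *)

Section DiscreteMeasurability.
Variables (d : measure_display) (T : measurableType d).

Definition dmeas (U : Type) (X : T -> U) := forall v, measurable [set w | X w = v].

Lemma dmeas_cst (U : Type) (c : U) : dmeas (fun=> c).
Proof.
move=> v; have [->|cv] := pselect (c = v).
  by rewrite (_ : [set w | v = v] = [set: T]) //; apply/seteqP; split.
by rewrite (_ : [set w | c = v] = classical_sets.set0) //; apply/seteqP; split.
Qed.

Lemma dmeas_bind (U : countType) (V : Type) (X : T -> U) (Y : U -> T -> V) :
  dmeas X -> (forall u, dmeas (Y u)) -> dmeas (fun w => Y (X w) w).
Proof.
move=> mX mY v.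
rewrite (_ : [set w | Y (X w) w = v] = \bigcup_k
   (if unpickle k is Some u then [set w | X w = u] `&` [set w | Y u w = v]
    else classical_sets.set0)).
  apply: bigcupT_measurable => k; case: (unpickle k) => [u|] //.
  by apply: measurableI; [exact: mX|exact: mY].
apply/seteqP; split => [w /= h|w [k _]].
  by exists (pickle (X w)) => //; rewrite pickleK.
by case: (unpickle k) => // u [/= -> ].
Qed.

Lemma dmeas_comp (U : countType) (V : Type) (f : U -> V) (X : T -> U) :
  dmeas X -> dmeas (fun w => f (X w)).
Proof. by move=> mX; apply: (dmeas_bind (Y := fun u _ => f u)) => // u; apply: dmeas_cst. Qed.

Lemma dmeas_comp2 (U U' : countType) (V : Type) (f : U -> U' -> V) (X : T -> U) (Y : T -> U') :
  dmeas X -> dmeas Y -> dmeas (fun w => f (X w) (Y w)).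
Proof.
move=> mX mY; apply: (dmeas_bind (Y := fun u w => f u (Y w))) => // u; exact: dmeas_comp.
Qed.

Lemma dmeas_map (I : Type) (U : countType) (X : I -> T -> U) (r : seq I) :
  (forall i, dmeas (X i)) -> dmeas (fun w => [seq X i w | i <- r]).
Proof.
move=> mX; elim: r => [|i r IH] /=; first exact: dmeas_cst.
exact: (dmeas_comp2 cons).
Qed.

End DiscreteMeasurability.

(** * Finite additivity for Boolean events *)

Section FiniteAdditivity.
Variables (d : measure_display) (T : measurableType d) (R : realType) (P : probability T R).

Definition pr (b : T -> bool) : R := fine (P [set w | b w]).

Lemma dmeas_bool (b : T -> bool) : dmeas b -> measurable [set w | b w].
Proof. by move=> /(_ true). Qed.

Lemma pr_ge0 b : 0 <= pr b.
Proof. by rewrite fine_ge0. Qed.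

Lemma pr_le1 b : dmeas b -> pr b <= 1.
Proof.
move=> /dmeas_bool mb; rewrite -lee_fin fineK ?fin_num_measure //.
exact: probability_le1.
Qed.

(** The equation between naturals says that [b] is the disjoint union of the [B i], in the form
    supplied by [prefix_del]. *)
Lemma pr_sum (I : Type) (r : seq I) (B : I -> T -> bool) (b : T -> bool) :
  dmeas b -> (forall i, dmeas (B i)) ->
  (forall w, b w = (\sum_(i <- r) B i w)%N :> nat) -> pr b = \sum_(i <- r) pr (B i).
Proof.
move=> mb mB; elim: r b mb => [|i r IH] b mb bE.
  rewrite big_nil /pr (_ : [set w | b w] = classical_sets.set0) ?measure0 //.
  by apply/seteqP; split => // w /=; have := bE w; rewrite big_nil; case: (b w).
pose b' w := b w && ~~ B i w.
have mb' : dmeas b' by apply: (dmeas_comp2 (fun x y => x && ~~ y)).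
rewrite big_cons -(IH b') //; last first.
  by move=> w; have := bE w; rewrite big_cons /b'; case: (b w); case: (B i w) => //= -[].
rewrite /pr -fineD ?fin_num_measure //; [|exact: dmeas_bool..].
rewrite -measureU; [|exact: dmeas_bool|exact: dmeas_bool|].
- congr (fine (P _)); apply/seteqP; split => w /=; rewrite /b'.
    by move=> ->; case: (B i w); [left|right].
  case=> [Bi|/andP[] //]; have := bE w; rewrite big_cons Bi.
  by case: (b w).
- by apply/seteqP; split => // w [/=]; rewrite /b' => ->; rewrite andbF.
Qed.

End FiniteAdditivity.

(** * The law of the remaining word and of the ranks *)

Section MultiQueue.
Variables (R : realType) (n : nat) (sigma : 'I_n -> R).
Hypotheses (n_gt0 : (0 < n)%N) (sigma_ge0 : forall i, 0 <= sigma i)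
  (sigma_sum1 : \sum_(i < n) sigma i = 1)
  (sigma_cond : forall i : nat, (0 < i < n)%N -> i%:R / n%:R < sigma_le sigma i).

Local Notation t := (sigma_le sigma).
Let l0 : 'I_n := Ordinal n_gt0.

Lemma sigma_leS (k : 'I_n) : t k.+1 - t k = sigma k.
Proof.
rewrite /sigma_le (bigD1 k) /= ?ltnS // -[RHS]addr0 -[in RHS](subrr (t k)) addrA.
congr (_ + _ - _); apply: eq_bigl => j.
by rewrite ltnS andbC [in RHS]ltn_neqAle.
Qed.

Lemma sigma_le0 : t 0 = 0.
Proof. by rewrite /sigma_le big_pred0. Qed.

Lemma sigma_le_mono k : t k <= t k.+1.
Proof.
rewrite /sigma_le big_mkcond [leRHS]big_mkcond; apply: ler_sum => j _.
by case: ltnP => [/leqW ->|_] //; case: ifP.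
Qed.

Lemma sigma_le_le1 k : t k <= 1.
Proof.
rewrite -sigma_sum1 /sigma_le big_mkcond; apply: ler_sum => j _.
by case: ifP.
Qed.

Lemma sigma_le_n : t n = 1.
Proof. by rewrite -sigma_sum1 /sigma_le; apply: eq_bigl => j; rewrite ltn_ord. Qed.

Variables (d : measure_display) (T : measurableType d) (P : probability T R)
  (A C : nat -> T -> 'I_n).
Hypotheses (AC_rv : discrete_rvs (join_rv A C))
  (AC_indep : mutually_independent P (join_rv A C))
  (A_unif : forall k j, fine (P [set w | A k w = j]) = n%:R^-1)
  (C_sigma : forall t i, fine (P [set w | C t w = i]) = sigma i).

Let removed s w := mq_removed (fun k => A k w) (fun t => C t w) s.
Let window H s w := [seq A k w | k <- rest H (removed s w)].

Lemma dmeas_A k : dmeas (A k). Proof. exact: (AC_rv (inl k)). Qed.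
Lemma dmeas_C k : dmeas (C k). Proof. exact: (AC_rv (inr k)). Qed.

Lemma dmeas_qtop D j : dmeas (fun w => qtop (fun k => A k w) D j).
Proof.
have mS t : measurable [set w | qtop (fun k => A k w) D j = Some t].
  rewrite (_ : [set w | _] = [set w | [&& A t w == j, t \notin D
      & all (fun x : bool * bool => x.1 ==> x.2) [seq (k \notin D, A k w != j) | k <- iota 0 t]]]).
    apply: dmeas_bool; apply: (dmeas_comp2 (fun x y => [&& x == j, t \notin D & all _ y])).
      exact: dmeas_A.
    by apply: dmeas_map => k; apply: (dmeas_comp (fun x => (k \notin D, x != j))); exact: dmeas_A.
  apply/seteqP; split => w /=.
    move=> /qtopP[/eqP-> -> h] /=; apply/allP => _ /mapP[k + ->] /=.
    by rewrite mem_iota => /andP[_ kt]; apply/implyP; apply: h.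
  move=> /and3P[/eqP aj tD /allP h]; apply/qtopP; split => // k kt kD.
  have := h (k \notin D, A k w != j); rewrite kD /=; apply.
  by apply/mapP; exists k; rewrite ?mem_iota ?kD.
case=> [t|]; first exact: mS.
rewrite (_ : [set w | _] = ~` \bigcup_t [set w | qtop (fun k => A k w) D j = Some t]).
  by apply: measurableC; apply: bigcupT_measurable.
apply/seteqP; split => w /=.
  by move=> E [t _ /=]; rewrite E.
by case E: (qtop _ _ _) => [t|//] h; case: h; exists t.
Qed.

Lemma dmeas_tops D : dmeas (fun w => tops (fun k => A k w) D).
Proof.
apply: (dmeas_comp (sort leq)); elim: (enum 'I_n) => [|j r IH] /=; first exact: dmeas_cst.
by apply: (dmeas_comp2 (fun x y => oapp (cons^~ y) y x)) => //; exact: dmeas_qtop.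
Qed.

Lemma dmeas_removed s : dmeas (removed s).
Proof.
elim: s => [|s IH]; first exact: dmeas_cst.
apply: (dmeas_bind (Y := fun D w => mq_step (fun k => A k w) D (C s w))) => // D.
apply: (dmeas_comp2 (fun l (c : 'I_n) => if (c < size l)%N then nth 0%N l c :: D else D)).
  exact: dmeas_tops.
exact: dmeas_C.
Qed.

Lemma dmeas_window H s : dmeas (window H s).
Proof.
apply: (dmeas_bind (Y := fun D w => [seq A k w | k <- rest H D])); first exact: dmeas_removed.
by move=> D; apply: dmeas_map; exact: dmeas_A.
Qed.

Lemma dmeas_rank s i : dmeas (fun w => mq_rank (fun k => A k w) (fun t => C t w) s i).
Proof.
apply: (dmeas_bind (Y := fun D w => let l := tops (fun k => A k w) D in
  if (i < size l)%N then rank_in D (nth 0%N l i) else 0%N)); first exact: dmeas_removed.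
move=> D; apply: (dmeas_comp (fun l => if (i < size l)%N then rank_in D (nth 0%N l i) else 0%N)).
exact: dmeas_tops.
Qed.

Fixpoint cmatch (s : nat) (gam : seq 'I_n) (w : T) : bool :=
  if gam is x :: gam' then (C s w == x) && cmatch s.+1 gam' w else true.

Lemma dmeas_cmatch s gam : dmeas (cmatch s gam).
Proof.
elim: gam s => [|x gam IH] s /=; first exact: dmeas_cst.
apply: (dmeas_comp2 (fun y b => (y == x) && b)) => //; exact: dmeas_C.
Qed.

Lemma cmatchP s gam w :
  cmatch s gam w <-> forall k, (k < size gam)%N -> C (s + k) w = nth l0 gam k.
Proof.
elim: gam s => [|x gam IH] s /=; first by split.
split=> [/andP[/eqP Cx /IH h] [|k] kg|h]; first by rewrite addn0.
  by rewrite -addSnnS h.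
apply/andP; split; first by apply/eqP; have := h 0%N; rewrite addn0; apply.
by apply/IH => k kg; rewrite addSnnS; exact: (h k.+1).
Qed.

Lemma pr_window0 H u gam : (size u <= H)%N ->
  pr P (fun w => prefix u (window H 0 w) && cmatch 0 gam w)
  = n%:R^-1 ^+ size u * \prod_(x <- gam) sigma x.
Proof.
(* The left summand of [J] indexes the initial letters and the right one the sampled labels, so one
   use of joint independence covers both. *)
move=> uH; pose J : seq (nat + nat) := map inl (iota 0 (size u)) ++ map inr (iota 0 (size gam)).
pose x (j : nat + nat) := match j with inl k => nth l0 u k | inr k => nth l0 gam k end.
have uJ : uniq J.
  rewrite cat_uniq !map_inj_uniq ?iota_uniq ?andbT /=; [|by move=> ? ? []..].
  by apply/hasPn => _ /mapP[k _ ->]; apply/mapP => -[].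
have wE w : window H 0 w = [seq A k w | k <- iota 0 H].
  by rewrite /window /rest /= filter_predT.
have := AC_indep x uJ; rewrite big_cat /= !big_map /=.
under eq_bigr do rewrite A_unif.
under [X in _ * X]eq_bigr do rewrite C_sigma.
rewrite big_const_seq count_predT size_iota iter_mulr_1.
rewrite -(big_map (nth l0 gam) xpredT sigma).
rewrite (_ : [seq nth l0 gam i | i <- iota 0 (size gam)] = gam); last first.
  exact: (mkseq_nth l0 gam).
move=> <-; rewrite /pr; congr (fine (P _)); apply/seteqP; split => w /=.
  rewrite wE => /andP[]; rewrite prefixE => /eqP pE /cmatchP h j.
  rewrite mem_cat => /orP[] /mapP[k + ->] /=; rewrite mem_iota => /= ku; last by rewrite h.
  rewrite -pE nth_take // (nth_map 0%N) ?size_iota ?(leq_trans ku) // nth_iota //.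
  exact: leq_trans ku uH.
move=> h; apply/andP; split; last first.
  apply/cmatchP => k kg; apply: (h (inr k)).
  by rewrite mem_cat map_f ?orbT // mem_iota.
rewrite prefixE wE; apply/eqP; apply: (@eq_from_nth _ l0).
  by rewrite size_takel // size_map size_iota.
move=> k; rewrite size_takel ?size_map ?size_iota // => ku.
rewrite nth_take // (nth_map 0%N) ?size_iota ?nth_iota ?(leq_trans ku) //.
by apply: (h (inl k)); rewrite mem_cat map_f // mem_iota.
Qed.

Local Notation gs s := (iter s (del_op t) (@initial R n)).

(* The labels of later deletions are carried along, so that independence is needed at
   time 0 only, where it is the hypothesis on A and C. *)
Lemma pr_window_match s H u gam : full u -> (size u + s <= H)%N ->
  pr P (fun w => prefix u (window H s w) && cmatch s gam w)
  = gs s u * \prod_(x <- gam) sigma x.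
Proof.
elim: s u gam => [|s IH] u gam fu uH.
  by rewrite pr_window0 ?(leq_trans _ uH) ?leq_addr //= /initial fu.
(* By [eP] the index is below [n], so the default [l0] is never taken. *)
pose cc (e : nat * seq 'I_n) := insubd l0 e.1.
have eP e : e \in allpreds u ->
    [/\ (e.1 < n)%N, val (cc e) = e.1, full e.2 & size e.2 = (size u).+1].
  move=> /flattenP[_ /mapP[l _ ->] ep].
  have en : (e.1 < n)%N by apply: preds_lt ep; rewrite finset.in_set0.
  split; rewrite ?val_insubd ?en //; first exact: full_preds ep.
  by rewrite (perm_size (preds_perm ep)).
have mw : dmeas (window H s.+1) by exact: dmeas_window.
(* The prefix [u] at time [s.+1] comes from a unique predecessor [e.2] at time [s] with label [e.1],
   which is put in front of [gam]. *)
rewrite (@pr_sum _ _ _ _ _ (allpreds u)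
  (fun e w => prefix e.2 (window H s w) && cmatch s (cc e :: gam) w)).
- rewrite iterS {1}/del_op fu -big_allpreds mulr_suml; apply: eq_big_seq => e /eP[en ev fe se].
  rewrite IH //; last by rewrite se addSnnS.
  by rewrite big_cons -ev sigma_leS mulrA [gs s _ * _]mulrC.
- apply: (dmeas_comp2 (fun y b => prefix u y && b)) => //; exact: dmeas_cmatch.
- move=> e; apply: (dmeas_comp2 (fun y b => prefix e.2 y && b)); first exact: dmeas_window.
  exact: dmeas_cmatch.
move=> w; rewrite /window {1}/removed /= prefix_mq_step //.
rewrite -/(removed s w) -mulnb prefix_del_all // big_distrl /=.
apply: eq_big_seq => e /eP[en ev _ _]; rewrite mulnb -(inj_eq val_inj) /= ev.
by rewrite [_ == e.1]eq_sym -andbA andbCA andbA.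
Qed.

Lemma pr_window s H u : full u -> (size u + s <= H)%N ->
  pr P (fun w => prefix u (window H s w)) = gs s u.
Proof.
move=> fu uH; rewrite -[RHS]mulr1 -(big_nil 1 *%R xpredT sigma) -(@pr_window_match _ H) //.
by congr pr; apply/funext => w /=; rewrite andbT.
Qed.

Lemma sum_prefix N (L : seq (seq 'I_n)) y : uniq L -> (forall u, u \in L -> size u = N) ->
  (\sum_(u <- L) prefix u y)%N = (take N y \in L).
Proof.
move=> uL sL; rewrite -(count_uniq_mem _ uL) -sum1_count [RHS]big_mkcond /=.
by apply: eq_big_seq => u /sL uN; rewrite prefixE uN eq_sym; case: eqP.
Qed.

Lemma gs_cvg_lsum :
  (forall u, (fun s => gs s u) @ \oo --> stationary t u) /\
  (forall s, (fun N => lsum N (gs s)) @ \oo --> (1 : R)).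
Proof.
have c0 : 0 < norm_cst n t.
  by apply: norm_cst_gt0 => //; [exact: sigma_le_mono|exact: sigma_le_n].
have M0 : 0 <= n%:R^-1 ^+ n / norm_cst n t.
  by rewrite divr_ge0 ?exprn_ge0 ?invr_ge0 // ltW.
have gM (u : seq 'I_n) : initial R u <= n%:R^-1 ^+ n / norm_cst n t * stationary t u.
  by apply: initial_le => //; [exact: sigma_le_mono|exact: sigma_le_le1|exact: sigma_le_n].
have g00 := initial_ge0 R (n := n).
have ag := admissible_initial R n.
have Sg := @lsum_initial_cvg R n n_gt0.
split=> [u|s].
  exact: (iter_del_cvg n_gt0 sigma_le0 sigma_le_mono sigma_le_le1 sigma_le_n sigma_cond
    ag g00 M0 gM Sg).
exact: (lsum_iter_del_cvg n_gt0 sigma_le0 sigma_le_mono sigma_le_le1 sigma_le_n sigma_cond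
  ag g00 M0 gM Sg).
Qed.

Variable v : 'I_n -> nat.
Let ranks_eq s w := [forall i, mq_rank (fun k => A k w) (fun t => C t w) s i == v i].

Lemma dmeas_ranks_eq s : dmeas (ranks_eq s).
Proof.
have -> : ranks_eq s = fun w => [seq mq_rank (fun k => A k w) (fun t => C t w) s i | i <- enum 'I_n]
    == [seq v i | i <- enum 'I_n].
  apply/funext => w; apply/forallP/eqP => [h|h i].
    by apply: eq_map => i; apply/eqP.
  by move/eq_in_map: h => h; apply/eqP/h; rewrite mem_enum.
apply: (dmeas_comp (fun l => l == _)); apply: dmeas_map => i; exact: dmeas_rank.
Qed.

Lemma ranks_eq_cvg ds : n = (size ds).+1 -> all (ltn 0%N) ds ->
  (forall i : 'I_n, v i = (sumn (take i ds)).+1) ->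
  (fun s => pr P (ranks_eq s)) @ \oo
  --> \prod_(j < size ds) geom1_pmf (1 - gap_ratio n t j.+1) (nth 0%N ds j).
Proof.
move=> nE ds0 vE; rewrite -stationary_gap_bits //.
set N := size (gap_bits ds); have NE : N = (sumn ds).+1 by exact: size_gap_bits.
set L := [seq u <- words n N | first_marks set0 u == gap_bits ds].
have LN u : u \in L -> size u = N by rewrite mem_filter mem_words => /andP[_ /eqP].
have Lfull u : u \in L -> full u.
  rewrite mem_filter /full -count_bits cards0 addn0 => /andP[/eqP-> _].
  by rewrite -(size_true_pos 0) true_pos_gap_bits // size_map size_iota -nE.
(* The rank event is a finite disjoint union of prefix events, over the words whose marks are
   [gap_bits ds]; at time [s] a window of size [N + s] suffices. *)
have -> : (fun s => pr P (ranks_eq s)) = (fun s => \sum_(u <- L) gs s u).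
  apply/funext => s; rewrite (@pr_sum _ _ _ _ _ L (fun u w => prefix u (window (N + s) s w))).
  - by apply: eq_big_seq => u uL; rewrite pr_window ?LN ?Lfull.
  - exact: dmeas_ranks_eq.
  - by move=> u; apply: (dmeas_comp (prefix u)); exact: dmeas_window.
  move=> w; rewrite (sum_prefix _ _ LN) ?filter_uniq ?words_uniq //; congr nat_of_bool.
  have := @mq_rank_gap_bits n (fun k => A k w) (fun t => C t w) (N + s) s ds nE ds0.
  rewrite NE => /(_ (leqnn _)) rk; apply/forallP/idP => [h|].
    have [|u ub] := rk.1 _; first by move=> i; rewrite (eqP (h i)).
    have uN : size u = (sumn ds).+1 by rewrite -(size_bits set0) ub -NE.
    rewrite prefixE uN => /eqP; rewrite /window /removed => ->.
    by rewrite mem_filter ub eqxx mem_words NE uN eqxx.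
  rewrite mem_filter => /andP[/eqP ub _] i; apply/eqP; rewrite vE; apply: rk.2.
  eexists; first exact: ub.
  by apply/prefixP; exists (drop (sumn ds).+1 (window ((sumn ds).+1 + s) s w)); rewrite cat_take_drop.
rewrite -[X in _ --> X]big_filter.
by apply: cvg_big => [|u _]; [exact: add_continuous|exact: gs_cvg_lsum.1].
Qed.

(* This includes the vectors v with an entry 0, the junk rank of an empty queue, for
   which the event is null but not empty. *)
Lemma ranks_eq_null s :
  (forall u : seq 'I_n, full u -> ~ forall i : 'I_n, v i = (nth 0%N (true_pos 0 (first_marks set0 u)) i).+1) ->
  pr P (ranks_eq s) = 0.
Proof.
move=> vbad; apply/eqP; rewrite eq_le pr_ge0 andbT.
(* The rank event is disjoint from the first [N] letters forming a full word, whose probability is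
   [lsum N (gs s)]; in the list below [None] stands for the rank event. *)
have key N : pr P (ranks_eq s) <= 1 - lsum N (gs s).
  set L := [seq u <- words n N | full u].
  have LN u : u \in L -> size u = N by rewrite mem_filter mem_words => /andP[_ /eqP].
  have Lf u : u \in L -> full u by rewrite mem_filter => /andP[].
  have -> : lsum N (gs s) = \sum_(u <- L) gs s u.
    rewrite big_filter big_mkcond /lsum; apply: eq_bigr => u _; case: ifPn => // fu.
    by have [_ ->] : admissible (gs s) by apply: admissible_iter_del; exact: admissible_initial.
  pose b w := ranks_eq s w || (take N (window (N + s) s w) \in L).
  have mW : dmeas (window (N + s) s) by exact: dmeas_window.
  have mb : dmeas b.
    by apply: (dmeas_comp2 (fun x y => x || (take N y \in L))) => //; exact: dmeas_ranks_eq.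
  have := pr_le1 P mb.
  rewrite (@pr_sum _ _ _ _ _ (None :: map Some L)
    (fun o w => if o is Some u then prefix u (window (N + s) s w) else ranks_eq s w)) //.
  - rewrite big_cons big_map lerBrDr.
    by under eq_big_seq => u uL do rewrite pr_window ?LN ?Lf //.
  - by case=> [u|]; [apply: (dmeas_comp (prefix u))|exact: dmeas_ranks_eq].
  move=> w; rewrite big_cons big_map (sum_prefix _ _ LN) ?filter_uniq ?words_uniq // /b.
  case: (boolP (ranks_eq s w)) => // /forallP rk.
  case: (boolP (_ \in L)) => // /Lf fu; case: (vbad _ fu) => i.
  rewrite -(eqP (rk i)); apply: (mq_rank_prefix _ fu); apply/prefixP.
  by exists (drop N (window (N + s) s w)); rewrite cat_take_drop.
apply: (@ler_cvg_to _ _ _ _ (fun=> pr P (ranks_eq s)) (fun N => 1 - lsum N (gs s))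
  _ 0 (cvg_cst _ (F := \oo))).
- by rewrite -[X in _ --> X](subrr 1); apply: cvgB; [exact: cvg_cst|exact: gs_cvg_lsum.2].
- exact: nearW.
Qed.

End MultiQueue.

(** * The mass function of the limit vector *)

Section LimitVector.
Variables (R : realType) (n : nat) (sigma : 'I_n -> R).
Hypothesis n_gt0 : (0 < n)%N.
Variables (d : measure_display) (T : measurableType d) (P : probability T R)
  (Delta : 'I_n.-1 -> T -> nat).
Hypotheses (Delta_indep : mutually_independent P Delta)
  (Delta_geom : forall (j : 'I_n.-1) (k : nat),
     fine (P [set w | Delta j w = k]) =
     geom1_pmf (1 - (j.+1)%:R / (n%:R * sigma_le sigma j.+1)) k).
Variable v : 'I_n -> nat.
Let vn k := v (insubd (Ordinal n_gt0) k).

Lemma limit_rankP w : (forall i, limit_rank Delta w i = v i) <->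
  (vn 0 = 1%N /\ forall j : 'I_n.-1, vn j.+1 = (vn j + Delta j w)%N).
Proof.
have part j : (\sum_(i < n.-1 | (i < j.+1)%N) Delta i w =
    \sum_(i < n.-1 | (i < j)%N) Delta i w + \sum_(i < n.-1 | i == j :> nat) Delta i w)%N.
  rewrite [LHS](bigID (fun i : 'I_n.-1 => (i < j)%N)) /=; congr (_ + _)%N; apply: eq_bigl => i.
    by rewrite ltnS; case: (ltngtP i j).
  by rewrite ltnS; case: (ltngtP i j).
have vnE (i : 'I_n) : vn i = v i by rewrite /vn valKd.
have one (j : 'I_n.-1) : (\sum_(i < n.-1 | i == j :> nat) Delta i w = Delta j w)%N.
  by rewrite (eq_bigl (pred1 j)) ?big_pred1_eq.
split=> [h|[v0 vS] i].
  have hn k : (k < n)%N -> vn k = (1 + \sum_(j < n.-1 | (j < k)%N) Delta j w)%N.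
    by move=> kn; have /= -> := vnE (Ordinal kn); rewrite -h.
  split; first by rewrite hn // big_pred0.
  move=> j; have jn : (j.+1 < n)%N by rewrite -ltn_predRL.
  by rewrite !hn ?(ltnW jn) // part one addnA.
rewrite -vnE /limit_rank; case: i => k /= kn.
elim: k kn => [|k IH] kn; first by rewrite v0 big_pred0.
have kn' : (k < n.-1)%N by rewrite ltn_predRL.
by rewrite part (one (Ordinal kn')) addnA IH ?(ltnW kn) // (vS (Ordinal kn')).
Qed.

Lemma limit_prob : vn 0 = 1%N -> (forall j, (j < n.-1)%N -> (vn j <= vn j.+1)%N) ->
  fine (P [set w | forall i, limit_rank Delta w i = v i]) =
  \prod_(j < n.-1) geom1_pmf (1 - gap_ratio n (sigma_le sigma) j.+1) (vn j.+1 - vn j).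
Proof.
move=> v0 vS.
rewrite (_ : [set w | _] = [set w | forall j, j \in enum 'I_n.-1 ->
    Delta j w = (fun j : 'I_n.-1 => vn j.+1 - vn j)%N j]); last first.
  apply/seteqP; split => w /=.
    by move=> /limit_rankP[_ h] j _; rewrite h addKn.
  by move=> h; apply/limit_rankP; split => // j; rewrite h ?mem_enum // subnKC // vS.
rewrite (Delta_indep _ (enum_uniq _)) big_enum; apply: eq_bigr => j _.
exact: Delta_geom.
Qed.

(** If [v] decreases somewhere or does not start at [1], the event is empty; if an entry repeats, a
    gap must be [0], where [geom1_pmf] vanishes. *)
Lemma limit_prob_null :
  ~ (vn 0 = 1%N /\ forall j, (j < n.-1)%N -> (vn j < vn j.+1)%N) ->
  fine (P [set w | forall i, limit_rank Delta w i = v i]) = 0.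
Proof.
move=> vbad.
have [[v0 vS]|nle] := pselect (vn 0 = 1%N /\ forall j, (j < n.-1)%N -> (vn j <= vn j.+1)%N).
  rewrite limit_prob //; apply/eqP/prodf_eq0.
  have [/existsP[j /eqP vj]|/existsPn nej] := boolP [exists j : 'I_n.-1, vn j.+1 == vn j].
    by exists j => //; rewrite vj subnn.
  case: vbad; split => // j jn; rewrite ltn_neqAle vS // andbT eq_sym.
  exact: (nej (Ordinal jn)).
rewrite (_ : [set w | _] = classical_sets.set0) ?measure0 //; apply/seteqP; split => // w /=.
move=> /limit_rankP[v0 h]; case: nle; split => // j jn.
by rewrite (h (Ordinal jn)) leq_addr.
Qed.

End LimitVector.

(** For vectors in a countable discrete set, convergence in distribution to a probability law is
    convergence of the mass at each point [v]. *)
Theorem theorem1 (R : realType) (n : nat) (sigma : 'I_n -> R)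
  (sigma_ge0 : forall i, 0 <= sigma i)
  (sigma_sum1 : \sum_(i < n) sigma i = 1)
  (sigma_cond : forall i : nat, (0 < i < n)%N -> i%:R / n%:R < sigma_le sigma i)
  (d : measure_display) (T : measurableType d) (P : probability T R)
  (A : nat -> T -> 'I_n) (C : nat -> T -> 'I_n)
  (AC_rv : discrete_rvs (join_rv A C))
  (AC_indep : mutually_independent P (join_rv A C))
  (A_unif : forall k j, fine (P [set w | A k w = j]) = n%:R^-1)
  (C_sigma : forall t i, fine (P [set w | C t w = i]) = sigma i)
  (d' : measure_display) (T' : measurableType d') (P' : probability T' R)
  (Delta : 'I_n.-1 -> T' -> nat)
  (Delta_rv : discrete_rvs Delta)
  (Delta_indep : mutually_independent P' Delta)
  (Delta_geom : forall (j : 'I_n.-1) (k : nat),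
     fine (P' [set w | Delta j w = k]) =
     geom1_pmf (1 - (j.+1)%:R / (n%:R * sigma_le sigma j.+1)) k) :
  forall v : 'I_n -> nat,
    (fun s => fine (P [set w | forall i : 'I_n,
                       mq_rank (fun k => A k w) (fun t => C t w) s i = v i]))
      @ \oo --> fine (P' [set w | forall i : 'I_n, limit_rank Delta w i = v i]).
Proof.
move=> v.
have n_gt0 : (0 < n)%N.
  rewrite lt0n; apply/eqP => n0; move: sigma_sum1.
  rewrite big1 => [/esym/eqP|i _]; first by rewrite oner_eq0.
  by have := ltn_ord i; rewrite [X in (_ < X)%N]n0.
have -> : (fun s => fine (P [set w | forall i : 'I_n,
    mq_rank (fun k => A k w) (fun t => C t w) s i = v i]))
  = (fun s => pr P (fun w => [forall i, mq_rank (fun k => A k w) (fun t => C t w) s i == v i])).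
  apply/funext => s; congr (fine (P _)); apply/seteqP; split => w /=.
    by move=> h; apply/forallP => i; apply/eqP.
  by move=> /forallP h i; apply/eqP.
pose vn k := v (insubd (Ordinal n_gt0) k).
have vnE (i : 'I_n) : vn i = v i by rewrite /vn valKd.
(* Either [v] starts at [1] and increases strictly, with increments the gaps [ds], or both masses
   are [0]. *)
have [[v0 vS]|vbad] := pselect (vn 0 = 1%N /\ forall j, (j < n.-1)%N -> (vn j < vn j.+1)%N).
  rewrite (limit_prob Delta_indep Delta_geom (n_gt0 := n_gt0)) // => [|j /vS/ltnW //].
  pose ds := mkseq (fun j => vn j.+1 - vn j)%N n.-1.
  have szd : size ds = n.-1 by rewrite size_mkseq.
  have nE : n = (size ds).+1 by rewrite szd prednK.
  have ds0 : all (ltn 0%N) ds.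
    apply/(all_nthP 0%N) => j; rewrite szd => jn; rewrite nth_mkseq // /ltn /= subn_gt0.
    exact: vS.
  have vE (i : 'I_n) : v i = (sumn (take i ds)).+1.
    rewrite -vnE; case: i => k /=; elim: k => [|k IH] kn; first by rewrite take0 v0.
    have kn' : (k < n.-1)%N by rewrite ltn_predRL.
    rewrite (take_nth 0%N) ?szd // sumn_rcons -addSn -IH ?(ltnW kn) //.
    by rewrite nth_mkseq // subnKC // ltnW // vS.
  have := ranks_eq_cvg n_gt0 sigma_ge0 sigma_sum1 sigma_cond AC_rv AC_indep A_unif C_sigma nE ds0 vE.
  rewrite szd; under eq_bigr => j _ do rewrite nth_mkseq //.
  by [].
rewrite (limit_prob_null Delta_indep Delta_geom (n_gt0 := n_gt0)) //.
have -> : (fun s => pr P (fun w => [forall i, mq_rank (fun k => A k w) (fun t => C t w) s i == v i]))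
  = (fun=> 0).
  apply/funext => s.
  apply: (ranks_eq_null n_gt0 sigma_ge0 sigma_sum1 sigma_cond AC_rv AC_indep A_unif C_sigma).
  (* The first letter of a full word is always marked and marked positions increase, which would put
     [v] in the first case. *)
  move=> u fu h; apply: vbad; split.
    have /= -> := vnE (Ordinal n_gt0); rewrite h.
    by case: u fu {h} => [/fullP/(_ (Ordinal n_gt0))//|x u _] /=; rewrite finset.in_set0.
  move=> j jn; have jn1 : (j.+1 < n)%N by rewrite -ltn_predRL.
  have /= -> := vnE (Ordinal jn1); have /= -> := vnE (Ordinal (ltnW jn1)); rewrite !h ltnS.
  have := size_true_pos_full fu => st.
  by apply: (sorted_ltn_nth ltn_trans) => //; rewrite ?inE ?st ?(ltnW jn1) //; exact: true_pos_sorted.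
exact: cvg_cst.
Qed.
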